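(* Let $\mathcal S$ be the $N=1$ super Schrödinger algebra, $\mathfrak p=\mathrm{Span}_{\mathbb C}\{p,q,z,G\}$ (an ideal of $\mathcal S$), and assume that $\phi\colon\mathfrak p\to\mathbb C$ is a nonzero Lie superalgebra homomorphism. Let $$y_0=\phi(q)^2e+\phi(p)\phi(q)h-\phi(p)^2f,\qquad y_1=\phi(q)E+\phi(p)F.$$ Then every irreducible quasi-Whittaker $\mathcal S$-supermodule of type $\phi$ is isomorphic, up to parity shift, to the supermodule $$L_\xi(\phi):=W(\phi)\big/\bigl(\mathcal U(\mathcal S)(y_0-\xi1)w_\phi+\delta_{0,\xi}\,\mathcal U(\mathcal S)y_1w_\phi\bigr)$$ for a unique $\xi\in\mathbb C$.
   Context: $\mathcal S$ is the 9-dimensional complex Lie superalgebra with $\mathcal S_{\bar0}=\mathrm{Span}_{\mathbb C}\{e,f,h,p,q,z\}$, $\mathcal S_{\bar1}=\mathrm{Span}_{\mathbb C}\{E,F,G\}$ and nonzero brackets (up to super-antisymmetry): $[h,e]=2e$, $[h,f]=-2f$, $[h,p]=p$, $[h,q]=-q$, $[e,f]=h$, $[p,q]=z$, $[e,q]=p$, $[p,f]=-q$, $[h,E]=E$, $[h,F]=-F$, $[e,F]=-E$, $[f,E]=-F$, $[p,F]=G$, $[q,E]=G$, $[E,E]=2e$, $[F,F]=-2f$, $[G,G]=z$, $[E,F]=h$, $[E,G]=-p$, $[F,G]=q$. $\mathbb C$ is regarded as a purely even abelian Lie superalgebra (so $\phi(z)=\phi(G)=0$). For an $\mathcal S$-supermodule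 $V$, $V_\phi=\{v\in V\mid xv=\phi(x)v\ \forall x\in\mathfrak p\}$; $V$ is a quasi-Whittaker supermodule of type $\phi$ if it is generated by a homogeneous element of $V_\phi$. Irreducible means having no nonzero proper ($\mathbb Z_2$-graded) subsupermodule. Let $\mathbb C w_\phi$ be the one-dimensional $\mathfrak p$-supermodule, with $w_\phi$ even, given by $xw_\phi=\phi(x)w_\phi$; $W(\phi)=\mathrm{Ind}_{\mathfrak p}^{\mathcal S}\mathbb C w_\phi$. $\delta_{0,\xi}$ is the Kronecker delta. ''Isomorphic up to parity shift to $M$'' means isomorphic (by a parity-preserving isomorphism) to $M$ or to its parity shift. *)

(* Defs.v *)
From HB Require Import structures.
From mathcomp Require Import all_boot all_order all_algebra.
From mathcomp Require Import generic_quotient ring_quotient.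
From mathcomp Require Import boolp reals complex.
From mathcomp Require Import finmap.
From mathcomp.multinomials Require Import monalg.

Set Implicit Arguments.
Unset Strict Implicit.
Unset Printing Implicit Defensive.

Import GRing.Theory.
Local Open Scope ring_scope.
Local Open Scope quotient_scope.

Section Linear.
Variables (K : fieldType) (V : lmodType K).

Record subspace := Subspace {
  smem :> V -> Prop;
  smem0 : smem 0;
  smemP : forall a u v, smem u -> smem v -> smem (a *: u + v) }.

Definition smemb (N : subspace) : {pred V} := fun v => `[< N v >].

Lemma smemb_zmod N : zmod_closed (smemb N).
Proof.
split=> [|u v /asboolP Nu /asboolP Nv]; first by apply/asboolP/smem0.
by apply/asboolP; rewrite addrC -scaleN1r; apply: smemP.
Qed.
HB.instance Definition _ N := GRing.isZmodClosed.Build V (smemb N) (smemb_zmod N).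

Inductive lspan (A : V -> Prop) : V -> Prop :=
| lspan0 : lspan A 0
| lspanZD a u v : A u -> lspan A v -> lspan A (a *: u + v).

Lemma lspan_subproof A a u v : lspan A u -> lspan A v -> lspan A (a *: u + v).
Proof.
move=> Au Av; elim: Au => [|b x y Ax _ IH]; first by rewrite scaler0 add0r.
by rewrite scalerDr scalerA -addrA; apply: lspanZD.
Qed.

Definition lspan_subspace A := Subspace (lspan0 A) (@lspan_subproof A).

Variable N : subspace.
Definition lquot := Quotient.quot (smemb N).
HB.instance Definition _ := GRing.Zmodule.on lquot.
Definition lpi (v : V) : lquot := \pi_lquot v.

Lemma lpi_eq u v : lpi u = lpi v <-> N (u - v).
Proof.
split=> [/eqP|H]; first by rewrite /lpi -Quotient.idealrBE => /asboolP.
by apply/eqP; rewrite /lpi -Quotient.idealrBE; apply/asboolP.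
Qed.
Lemma lpiD u v : lpi (u + v) = lpi u + lpi v.
Proof. by rewrite /lpi !piE. Qed.
Lemma lpi0 : lpi 0 = 0.
Proof. by rewrite /lpi !piE. Qed.
Lemma lpi_surj w : exists v, lpi v = w.
Proof. by exists (repr w); rewrite /lpi reprK. Qed.

Definition lquot_scale (a : K) (w : lquot) : lquot := lpi (a *: repr w).
Lemma smemZ a v : N v -> N (a *: v).
Proof. by move=> Nv; rewrite -[_ *: _]addr0; apply: smemP => //; apply: smem0. Qed.
Lemma lquot_scaleE a v : lquot_scale a (lpi v) = lpi (a *: v).
Proof. by apply/lpi_eq; rewrite -scalerBr; apply/smemZ/lpi_eq; rewrite /lpi reprK. Qed.
Lemma lquot_scaleA a b v : lquot_scale a (lquot_scale b v) = lquot_scale (a * b) v.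
Proof. by have [x <-] := lpi_surj v; rewrite !lquot_scaleE scalerA. Qed.
Lemma lquot_scale1 : left_id 1 lquot_scale.
Proof. by move=> v; have [x <-] := lpi_surj v; rewrite lquot_scaleE scale1r. Qed.
Lemma lquot_scaleDr : right_distributive lquot_scale +%R.
Proof.
move=> a u v; have [x <-] := lpi_surj u; have [y <-] := lpi_surj v.
by rewrite -lpiD !lquot_scaleE scalerDr lpiD.
Qed.
Lemma lquot_scaleDl v : {morph lquot_scale^~ v : a b / a + b}.
Proof. by move=> a b /=; have [x <-] := lpi_surj v; rewrite !lquot_scaleE scalerDl lpiD. Qed.
HB.instance Definition _ := GRing.Zmodule_isLmodule.Build K lquot
  lquot_scaleA lquot_scale1 lquot_scaleDr lquot_scaleDl.
Lemma lpiZ a v : lpi (a *: v) = a *: lpi v.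
Proof. by rewrite -lquot_scaleE. Qed.
Lemma lpi_linear : linear lpi.
Proof. by move=> a u v; rewrite lpiD -lquot_scaleE. Qed.
HB.instance Definition _ := GRing.isLinear.Build K V lquot _ lpi lpi_linear.
End Linear.

Lemma linear_scale (K : fieldType) (V V' : lmodType K) (f : V -> V') :
  linear f -> forall a v, f (a *: v) = a *: f v.
Proof.
move=> fl a v.
pose g : {linear V -> V'} := HB.pack f (GRing.isLinear.Build _ _ _ _ f fl).
by have := linearZ_LR g a v.
Qed.
Lemma linear_add (K : fieldType) (V V' : lmodType K) (f : V -> V') :
  linear f -> forall u v, f (u + v) = f u + f v.
Proof. by move=> fl u v; rewrite -[u]scale1r fl !scale1r. Qed.

Lemma linear_sub (K : fieldType) (V V' : lmodType K) (f : V -> V') :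
  linear f -> forall u v, f (u - v) = f u - f v.
Proof.
by move=> fl u v; rewrite (linear_add fl) -scaleN1r (linear_scale fl) scaleN1r.
Qed.

Section LquotLift.
Variables (K : fieldType) (V W : lmodType K) (N : subspace V) (f : V -> W).

(* The map induced by f on the quotient; meaningful when f is linear and
   vanishes on N. *)
Definition lquot_lift (w : lquot N) : W := f (repr w).

Hypothesis f_lin : linear f.
Hypothesis f_N : forall v, N v -> f v = 0.

Lemma lquot_liftE v : lquot_lift (lpi N v) = f v.
Proof.
pose g : {linear V -> W} := HB.pack f (GRing.isLinear.Build _ _ _ _ f f_lin).
apply/eqP; rewrite -subr_eq0 -[_ - _](raddfB g); apply/eqP; apply: f_N.
by apply/lpi_eq; rewrite /lpi reprK.
Qed.

Lemma lquot_lift_linear : linear lquot_lift.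
Proof.
move=> a u v; have [x <-] := lpi_surj u; have [y <-] := lpi_surj v.
by rewrite -linearP !lquot_liftE f_lin.
Qed.
End LquotLift.

Section LquotMap.
Variables (K : fieldType) (V V' : lmodType K) (N : subspace V) (N' : subspace V').
Variable f : V -> V'.

Definition lquot_map : lquot N -> lquot N' := lquot_lift (fun v => lpi N' (f v)).

Hypothesis f_lin : linear f.
Hypothesis f_N : forall v, N v -> N' (f v).

Lemma lpi_f_linear : linear (fun v => lpi N' (f v)).
Proof. by move=> a u v; rewrite f_lin linearP. Qed.
Lemma lpi_f_ker v : N v -> lpi N' (f v) = 0.
Proof. by move=> Nv; rewrite -lpi0; apply/lpi_eq; rewrite subr0; apply: f_N. Qed.

Lemma lquot_mapE v : lquot_map (lpi N v) = lpi N' (f v).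
Proof. exact: lquot_liftE lpi_f_linear lpi_f_ker v. Qed.
Lemma lquot_map_linear : linear lquot_map.
Proof. exact: lquot_lift_linear lpi_f_linear lpi_f_ker. Qed.
End LquotMap.

Lemma lspan_ker (K : fieldType) (V W : lmodType K) (f : V -> W) (A : V -> Prop) :
  linear f -> (forall v, A v -> f v = 0) -> forall v, lspan A v -> f v = 0.
Proof.
move=> fl fA v; elim=> [|a x y Ax _ IH]; last by rewrite fl fA // IH scaler0 add0r.
by rewrite -(scale0r 0) (linear_scale fl) scale0r.
Qed.

Section MalgExt.
Variables (K : fieldType) (T : choiceType) (W : lmodType K).
Local Open Scope fset_scope.

Definition malg_ext (h : T -> W) (g : {malg K[T]}) : W :=
  \sum_(k <- msupp g) g@_k *: h k.

Lemma malg_extEw h (d : {fset T}) g :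
  msupp g `<=` d -> malg_ext h g = \sum_(k <- d) g@_k *: h k.
Proof.
move=> le_gd; rewrite /malg_ext.
rewrite (big_fset_incl _ le_gd) // => k _ /mcoeff_outdom ->.
by rewrite scale0r.
Qed.

Lemma malg_ext_linear h : linear (malg_ext h).
Proof.
move=> a u v; pose d := msupp u `|` msupp v.
have su : msupp u `<=` d by apply: fsubsetUl.
have sv : msupp v `<=` d by apply: fsubsetUr.
have suv : msupp (a *: u + v) `<=` d.
  apply: fsubset_trans (msuppD_le _ _) _; apply: fsetSU; exact: msuppZ_le.
rewrite !(malg_extEw _ su) !(malg_extEw _ sv) !(malg_extEw _ suv).
rewrite scaler_sumr -big_split /=; apply: eq_bigr => k _.
by rewrite mcoeffD mcoeffZ scalerDl scalerA.
Qed.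

Lemma malg_extU h k : malg_ext h << k >> = h k.
Proof.
by rewrite (malg_extEw _ msuppU_le) big_seq_fset1 mcoeffUU scale1r.
Qed.

Lemma malg_lin_eq (f g : {malg K[T]} -> W) :
  linear f -> linear g -> (forall k, f << k >> = g << k >>) -> f =1 g.
Proof.
move=> fl gl fg x.
pose f' : {linear {malg K[T]} -> W} := HB.pack f (GRing.isLinear.Build _ _ _ _ f fl).
pose g' : {linear {malg K[T]} -> W} := HB.pack g (GRing.isLinear.Build _ _ _ _ g gl).
rewrite (monalgE x) -[f _]/(f' _) -[g _]/(g' _) !linear_sum.
apply: eq_bigr => k _; have -> : << x@_k *g k >> = x@_k *: << k >>.
  by apply/malgP => k'; rewrite mcoeffZ !mcoeffU mulr_natr.
by rewrite !linearZ /= fg.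
Qed.
End MalgExt.

(* The free associative algebra K<X>: the free K-module on the words over X, with
   the product extending the concatenation of words. *)
Section FreeAlgebra.
Variables (K : fieldType) (X : choiceType).

Definition freealg : Type := {malg K[seq X]}.
HB.instance Definition _ := GRing.Lmodule.on freealg.

(* Locked, like the product, because terms of monalg unfold badly during
   unification. *)
Fact freealg_key : unit. Proof. by []. Qed.
Definition free_word : seq X -> freealg := locked_with freealg_key (fun s => << s >>).
Lemma free_wordE s : free_word s = << s >>.
Proof. by rewrite /free_word unlock. Qed.

Definition freealg_mul : freealg -> freealg -> freealg :=
  locked_with freealg_key (fun a b =>
    malg_ext (fun s => malg_ext (fun t => free_word (s ++ t)) b) a).
Definition freealg_one : freealg := free_word [::].

Lemma freealg_mull b : linear (freealg_mul^~ b).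
Proof. by rewrite /freealg_mul unlock; apply: malg_ext_linear. Qed.
Lemma freealg_mulr a : linear (freealg_mul a).
Proof.
rewrite /freealg_mul unlock => c u v.
rewrite /malg_ext -/(malg_ext _) scaler_sumr -big_split /=.
apply: eq_bigr => s _.
by rewrite -!/(malg_ext _ _) malg_ext_linear scalerDr !scalerA mulrC.
Qed.
Lemma freealg_mulU s t :
  freealg_mul (free_word s) (free_word t) = free_word (s ++ t).
Proof. by rewrite !free_wordE /freealg_mul unlock !malg_extU free_wordE. Qed.

Lemma freealg_mulA : associative freealg_mul.
Proof.
move=> a b c; move: a; apply: malg_lin_eq => [k u v|k u v|s].
- exact: freealg_mull.
- by rewrite (freealg_mull b) (freealg_mull c).
move: b; apply: malg_lin_eq => [k u v|k u v|t].
- by rewrite (freealg_mull c) freealg_mulr.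
- by rewrite freealg_mulr (freealg_mull c).
move: c; apply: malg_lin_eq => [k u v|k u v|w].
- by rewrite freealg_mulr freealg_mulr.
- exact: freealg_mulr.
by rewrite -!free_wordE !freealg_mulU catA.
Qed.
Lemma freealg_mul1 : left_id freealg_one freealg_mul.
Proof.
move=> a; move: a; apply: (malg_lin_eq (g := idfun)) => [|//|s].
  exact: freealg_mulr.
by rewrite -free_wordE freealg_mulU.
Qed.
Lemma freealg_mulr1 : right_id freealg_one freealg_mul.
Proof.
move=> a; move: a; apply: (malg_lin_eq (g := idfun)) => [|//|s].
  exact: freealg_mull.
by rewrite -free_wordE freealg_mulU cats0.
Qed.
Lemma freealg_mulDl : left_distributive freealg_mul +%R.
Proof. by move=> a b c; rewrite -[a]scale1r (freealg_mull c) !scale1r. Qed.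
Lemma freealg_mulDr : right_distributive freealg_mul +%R.
Proof. by move=> a b c; rewrite -[b]scale1r (freealg_mulr a) !scale1r. Qed.
Lemma freealg_one_neq0 : freealg_one != 0.
Proof. by rewrite /freealg_one free_wordE monalgU_eq0 oner_eq0. Qed.
HB.instance Definition _ := GRing.Zmodule_isNzRing.Build freealg
  freealg_mulA freealg_mul1 freealg_mulr1 freealg_mulDl freealg_mulDr
  freealg_one_neq0.

Lemma freealg_scalerAl (c : K) (a b : freealg) : c *: (a * b) = c *: a * b.
Proof. exact: esym (linear_scale (freealg_mull b) c a). Qed.
HB.instance Definition _ :=
  GRing.Lmodule_isLalgebra.Build K freealg freealg_scalerAl.
Lemma freealg_scalerAr (c : K) (a b : freealg) : c *: (a * b) = a * (c *: b).
Proof. exact: esym (linear_scale (freealg_mulr a) c b). Qed.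
HB.instance Definition _ :=
  GRing.Lalgebra_isAlgebra.Build K freealg freealg_scalerAr.

Lemma free_wordM s t : free_word s * free_word t = free_word (s ++ t).
Proof. exact: freealg_mulU. Qed.

Variable W : lmodType K.

Definition free_ext (h : seq X -> W) (a : freealg) : W := malg_ext h a.

Lemma free_ext_linear h : linear (free_ext h).
Proof. exact: malg_ext_linear. Qed.
Lemma free_extE h s : free_ext h (free_word s) = h s.
Proof. by rewrite free_wordE; apply: malg_extU. Qed.
Lemma free_lin_eq (f g : freealg -> W) :
  linear f -> linear g -> (forall s, f (free_word s) = g (free_word s)) -> f =1 g.
Proof. by move=> fl gl fg; apply: malg_lin_eq => // s; rewrite -free_wordE. Qed.
End FreeAlgebra.

Section FreeGrading.
Variables (K : fieldType) (X : choiceType) (par : X -> bool).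
Local Notation F := (freealg K X).

Definition word_parity (s : seq X) : bool := foldr (fun g b => par g (+) b) false s.

Definition word_hc (i : bool) : F -> F :=
  free_ext (fun s => if word_parity s == i then free_word K s else 0).

Lemma word_hc_linear i : linear (word_hc i).
Proof. exact: free_ext_linear. Qed.
HB.instance Definition _ i := GRing.isLinear.Build K F F _ (word_hc i) (word_hc_linear i).

Lemma word_hc_add i a b : word_hc i (a + b) = word_hc i a + word_hc i b.
Proof. exact: linear_add (word_hc_linear i) a b. Qed.
Lemma word_hc_scale i c a : word_hc i (c *: a) = c *: word_hc i a.
Proof. exact: linear_scale (word_hc_linear i) c a. Qed.
Lemma word_hc_sub i a b : word_hc i (a - b) = word_hc i a - word_hc i b.
Proof. by rewrite word_hc_add -scaleN1r word_hc_scale scaleN1r. Qed.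

Lemma word_hcE i s : word_hc i (free_word K s) =
  if word_parity s == i then free_word K s else 0.
Proof. exact: free_extE. Qed.

Lemma word_hcD f : word_hc false f + word_hc true f = f.
Proof.
move: f; apply: (free_lin_eq (g := idfun)) => [a u v|//|s].
  by rewrite !linearP /= scalerDr addrACA.
by rewrite !word_hcE; case: word_parity; rewrite ?addr0 ?add0r.
Qed.
Lemma word_hcK i j f : word_hc i (word_hc j f) = if i == j then word_hc j f else 0.
Proof.
move: f; apply: free_lin_eq => [a u v|a u v|s].
- by rewrite !linearP.
- by case: eqP; rewrite ?linearP // scaler0 addr0.
rewrite !word_hcE; have [<-|ne] := eqVneq (word_parity s) j.
  by rewrite word_hcE eq_sym.
by rewrite linear0 if_same.
Qed.

Lemma word_parity_cat s t : word_parity (s ++ t) = word_parity s (+) word_parity t.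
Proof.
rewrite /word_parity foldr_cat.
by elim: s => [|g s IH] //=; rewrite IH addbA.
Qed.

Lemma word_hcM i a b : word_hc i (a * b) =
  word_hc false a * word_hc i b + word_hc true a * word_hc (~~ i) b.
Proof.
move: a; apply: free_lin_eq => [c u v|c u v|s].
- by rewrite mulrDl -scalerAl linearP.
- by rewrite !linearP /= !mulrDl -!scalerAl scalerDr addrACA.
move: b; apply: free_lin_eq => [c u v|c u v|t].
- by rewrite mulrDr -scalerAr linearP.
- by rewrite !linearP /= !mulrDr -!scalerAr scalerDr addrACA.
rewrite free_wordM !word_hcE word_parity_cat.
by case: (word_parity s); case: (word_parity t); case: i;
  rewrite /= ?mul0r ?mulr0 ?addr0 ?add0r ?free_wordM.
Qed.
End FreeGrading.


(* A Z/2-graded space V = V_0 (+) V_1, given by its two projections: [hc i v]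
   is the component of [v] of parity [i] ([false] is even, [true] is odd). *)
Record superspace (K : fieldType) := Superspace {
  ss_sort :> lmodType K;
  hc : bool -> ss_sort -> ss_sort;
  hc_linear : forall i, linear (hc i);
  hcD : forall v, hc false v + hc true v = v;
  hcK : forall i j v, hc i (hc j v) = if i == j then hc j v else 0 }.
Arguments hc {K s} i v.

HB.instance Definition _ (K : fieldType) (V : superspace K) i :=
  GRing.isLinear.Build K V V _ (@hc K V i) (@hc_linear K V i).

Definition homog (K : fieldType) (V : superspace K) (i : bool) (v : V) : Prop :=
  hc i v = v.

Lemma homog_hc (K : fieldType) (V : superspace K) i (v : V) : homog i (hc i v).
Proof. by rewrite /homog hcK eqxx. Qed.

Definition sgn (K : fieldType) (i j : bool) : K := (-1) ^+ (i && j).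

Record lieSuperalgebra (K : fieldType) := LieSuperalgebra {
  ls_sort :> superspace K;
  br : ls_sort -> ls_sort -> ls_sort;
  br_linearl : forall y, linear (br^~ y);
  br_linearr : forall x, linear (br x);
  br_homog : forall i j x y,
    homog i x -> homog j y -> homog (i (+) j) (br x y);
  br_anti : forall i j x y,
    homog i x -> homog j y -> br x y = - (sgn K i j *: br y x);
  br_jacobi : forall i j x y z, homog i x -> homog j y ->
    br x (br y z) = br (br x y) z + sgn K i j *: br y (br x z) }.
Arguments br {K l} x y.

Record lieHom (K : fieldType) (L L' : lieSuperalgebra K) := LieHom {
  lh_fun :> L -> L';
  lh_linear : linear lh_fun;
  lh_homog : forall i x, homog i x -> homog i (lh_fun x);
  lh_br : forall x y, lh_fun (br x y) = br (lh_fun x) (lh_fun y) }.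

Record supermodule (K : fieldType) (L : lieSuperalgebra K) := Supermodule {
  sm_sort :> superspace K;
  act : L -> sm_sort -> sm_sort;
  act_linearl : forall v, linear (act^~ v);
  act_linearr : forall x, linear (act x);
  act_homog : forall i j x v,
    homog i x -> homog j v -> homog (i (+) j) (act x v);
  act_br : forall i j x y v, homog i x -> homog j y ->
    act (br x y) v = act x (act y v) - sgn K i j *: act y (act x v) }.
Arguments act {K L s} x v.

Record subsupermodule (K : fieldType) (L : lieSuperalgebra K)
    (M : supermodule L) := Subsupermodule {
  sub_space :> subspace M;
  sub_hc : forall i v, sub_space v -> sub_space (hc i v);
  sub_act : forall x v, sub_space v -> sub_space (act x v) }.

Section Supermodules.
Variables (K : fieldType) (L : lieSuperalgebra K).
Implicit Types M : supermodule L.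

(* The zero module is excluded, as usual. *)
Definition irreducible M : Prop :=
  (exists v : M, v <> 0) /\
  forall N : subsupermodule M, (forall v, N v -> v = 0) \/ (forall v, N v).

Definition generated_by M (v : M) : Prop :=
  forall N : subsupermodule M, N v -> forall u, N u.

Record sm_iso M M' := SmIso {
  iso_fun :> M -> M';
  iso_linear : linear iso_fun;
  iso_bij : bijective iso_fun;
  iso_homog : forall i v, homog i v -> homog i (iso_fun v);
  iso_act : forall x v, iso_fun (act x v) = act x (iso_fun v) }.

Definition isomorphic M M' : Prop := inhabited (sm_iso M M').

End Supermodules.

Lemma lieHom_hc (K : fieldType) (L L' : lieSuperalgebra K) (j : lieHom L L') i x :
  hc i (j x) = j (hc i x).
Proof.
rewrite -[in LHS](hcD x) (linear_add (@lh_linear _ _ _ j)).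
rewrite (linear_add (@hc_linear _ _ i)).
have E k l : hc k (j (hc l x)) = if k == l then j (hc l x) else 0.
  by rewrite -(@lh_homog _ _ _ j _ _ (homog_hc l x)) hcK; case: eqP.
by rewrite !E; case: i; rewrite /= ?addr0 ?add0r.
Qed.

Lemma act_hc (K : fieldType) (L : lieSuperalgebra K) (M : supermodule L) i x (n : M) :
  hc i (act x n) = act (hc false x) (hc i n) + act (hc true x) (hc (~~ i) n).
Proof.
have actD (y : L) : act y n = act y (hc i n) + act y (hc (~~ i) n).
  rewrite -(linear_add (@act_linearr _ _ M y)); congr act.
  by case: i; rewrite ?hcD // addrC hcD.
have E b k (y : L) (m : M) : hc i (act (hc b y) (hc k m)) =
    if i == b (+) k then act (hc b y) (hc k m) else 0.
  by rewrite -(act_homog (homog_hc b y) (homog_hc k m)) hcK; case: eqP.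
rewrite -[in LHS](hcD x) (linear_add (@act_linearl _ _ M n)) !actD.
rewrite !(linear_add (@hc_linear _ M i)) !E.
by case: i {actD E}; rewrite /= ?addr0 ?add0r.
Qed.

Section ParityShift.
Variables (K : fieldType) (L : lieSuperalgebra K) (M : supermodule L).

Definition shift_hc (i : bool) (v : M) : M := hc (~~ i) v.

Lemma shift_hc_linear i : linear (shift_hc i).
Proof. exact: hc_linear. Qed.
Lemma shift_hcD v : shift_hc false v + shift_hc true v = v.
Proof. by rewrite addrC hcD. Qed.
Lemma shift_hcK i j v :
  shift_hc i (shift_hc j v) = if i == j then shift_hc j v else 0.
Proof. by rewrite /shift_hc hcK (inj_eq negb_inj). Qed.
Definition shift_space := Superspace shift_hc_linear shift_hcD shift_hcK.

Lemma shift_act_homog i j (x : L) (v : shift_space) : homog i x -> homog j v ->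
  @homog K shift_space (i (+) j) (act x (v : M)).
Proof.
move=> hx hv; have: homog (i (+) ~~ j) (act x (v : M)) by apply: act_homog.
by rewrite addbN.
Qed.
Lemma shift_act_br i j (x y : L) (v : shift_space) : homog i x -> homog j y ->
  act (br x y) (v : M) =
    act x (act y (v : M)) - sgn K i j *: act y (act x (v : M)).
Proof. exact: act_br. Qed.

(* The other usual convention, x . v := (-1)^|x| x v, gives a module isomorphic
   to this one through v |-> (-1)^|v| v. *)
Definition parity_shift : supermodule L :=
  @Supermodule K L shift_space (fun x v => act x (v : M))
    (@act_linearl K L M) (@act_linearr K L M) shift_act_homog shift_act_br.
End ParityShift.

Definition isomorphic_up_to_parity (K : fieldType) (L : lieSuperalgebra K)
    (M M' : supermodule L) : Prop :=
  isomorphic M M' \/ isomorphic M (parity_shift M').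

Section QuotientModule.
Variables (K : fieldType) (L : lieSuperalgebra K) (M : supermodule L).
Variable N : subsupermodule M.

Definition quot_hc i : lquot N -> lquot N := lquot_map N (@hc K M i).
Lemma quot_hcE i v : quot_hc i (lpi N v) = lpi N (hc i v).
Proof. by rewrite /quot_hc lquot_mapE //; [apply: hc_linear|move=> u; apply: sub_hc]. Qed.
Lemma quot_hc_linear i : linear (quot_hc i).
Proof. by apply: lquot_map_linear => [|v]; [apply: hc_linear|apply: sub_hc]. Qed.
Lemma quot_hcD v : quot_hc false v + quot_hc true v = v.
Proof. by have [u <-] := lpi_surj v; rewrite !quot_hcE -linearD hcD. Qed.
Lemma quot_hcK i j v :
  quot_hc i (quot_hc j v) = if i == j then quot_hc j v else 0.
Proof.
have [u <-] := lpi_surj v; rewrite !quot_hcE hcK.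
by case: eqP => // _; rewrite linear0.
Qed.
Definition quot_space := Superspace quot_hc_linear quot_hcD quot_hcK.

Definition quot_act (x : L) : lquot N -> lquot N := lquot_map N (@act K L M x).
Lemma quot_actE x v : quot_act x (lpi N v) = lpi N (act x v).
Proof. by rewrite /quot_act lquot_mapE //; [apply: act_linearr|move=> u; apply: sub_act]. Qed.
Lemma quot_act_linearl v : linear (quot_act^~ v).
Proof.
move=> a x y /=; have [u <-] := lpi_surj v; rewrite !quot_actE.
by rewrite -linearP -(act_linearl u).
Qed.
Lemma quot_act_linearr x : linear (quot_act x).
Proof. by apply: lquot_map_linear => [|v]; [apply: act_linearr|apply: sub_act]. Qed.
Lemma quot_act_homog i j (x : L) (v : quot_space) :
  homog i x -> homog j v -> @homog K quot_space (i (+) j) (quot_act x v).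
Proof.
move=> hx; rewrite /homog /=; have [u <-] := lpi_surj v => hv.
rewrite -hv quot_hcE quot_actE quot_hcE.
by congr (lpi _ _); apply: act_homog => //; apply: homog_hc.
Qed.
Lemma quot_act_br i j (x y : L) (v : quot_space) : homog i x -> homog j y ->
  quot_act (br x y) v
  = quot_act x (quot_act y v) - sgn K i j *: quot_act y (quot_act x v).
Proof.
move=> hx hy; have [u <-] := lpi_surj v.
by rewrite !quot_actE (act_br u hx hy) linearB linearZ.
Qed.
Definition quot_supermodule : supermodule L := @Supermodule K L quot_space quot_act
  quot_act_linearl quot_act_linearr quot_act_homog quot_act_br.
End QuotientModule.

(* The universal enveloping algebra U(L). The generator (i, x) stands for the
   homogeneous component of parity i of x. *)
Section Enveloping.
Variables (K : fieldType) (L : lieSuperalgebra K).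

Definition env_sym : Type := (bool * L)%type.
HB.instance Definition _ := Choice.on env_sym.
Local Notation F := (freealg K env_sym).

Definition gen_parity (g : env_sym) : bool := g.1.

Definition env_gen (i : bool) (x : L) : F := free_word K [:: (i, x) : env_sym].

Inductive env_rel : F -> Prop :=
| env_rel_linear i a x y :
    env_rel (env_gen i (a *: x + y) - (a *: env_gen i x + env_gen i y))
| env_rel_hc i x : env_rel (env_gen i (hc i x) - env_gen i x)
| env_rel_br i j x y : homog i x -> homog j y ->
    env_rel (env_gen i x * env_gen j y - sgn K i j *: (env_gen j y * env_gen i x)
             - env_gen (i (+) j) (br x y)).

Definition env_ideal : subspace F :=
  lspan_subspace (fun f => exists a r b : F, env_rel r /\ f = a * r * b).

Lemma env_ideal_rel r : env_rel r -> env_ideal r.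
Proof.
move=> hr; rewrite -[r]addr0 -[r]scale1r; apply: lspanZD; last exact: lspan0.
by exists 1, r, 1; rewrite mul1r mulr1.
Qed.

Lemma env_idealM (a f b : F) : env_ideal f -> env_ideal (a * f * b).
Proof.
elim=> [|c u v [a' [r [b' [hr ->]]]] _ IH].
  by rewrite mulr0 mul0r; apply: lspan0.
rewrite mulrDr mulrDl -scalerAr -scalerAl; apply: lspanZD => //.
by exists (a * a'), r, (b' * b); split; rewrite // !mulrA.
Qed.

Definition env : Type := lquot env_ideal.
HB.instance Definition _ := GRing.Lmodule.on env.
Definition env_pi (f : F) : env := lpi env_ideal f.

Lemma env_pi_linear : linear env_pi.
Proof. exact: lpi_linear. Qed.
HB.instance Definition _ := GRing.isLinear.Build K F env _ env_pi env_pi_linear.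
Lemma env_piZ c f : env_pi (c *: f) = c *: env_pi f.
Proof. exact: lpiZ. Qed.
Lemma env_piD f g : env_pi (f + g) = env_pi f + env_pi g.
Proof. exact: lpiD. Qed.
Lemma env_pi_eq f g : env_pi f = env_pi g <-> env_ideal (f - g).
Proof. exact: lpi_eq. Qed.
Lemma env_pi_surj u : exists f, env_pi f = u.
Proof. exact: lpi_surj. Qed.

Fact env_key : unit. Proof. by []. Qed.
Definition env_one : env := env_pi 1.
Definition env_mul : env -> env -> env :=
  locked_with env_key (fun u v => env_pi ((repr u : F) * (repr v : F))).

Lemma env_mulE (a b : F) : env_mul (env_pi a) (env_pi b) = env_pi (a * b).
Proof.
rewrite /env_mul unlock; apply/env_pi_eq; set a' := repr _; set b' := repr _.
have ha : env_ideal (a' - a) by apply/env_pi_eq; rewrite /env_pi /lpi reprK.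
have hb : env_ideal (b' - b) by apply/env_pi_eq; rewrite /env_pi /lpi reprK.
have -> : a' * b' - a * b = 1 *: (1 * (a' - a) * b') + (a * (b' - b) * 1).
  by rewrite scale1r mul1r mulr1 mulrBl mulrBr addrA subrK.
by apply: smemP; apply: env_idealM.
Qed.

Lemma env_mulA : associative env_mul.
Proof.
move=> u v w; have [x <-] := env_pi_surj u; have [y <-] := env_pi_surj v.
by have [z <-] := env_pi_surj w; rewrite !env_mulE mulrA.
Qed.
Lemma env_mul1 : left_id env_one env_mul.
Proof. by move=> u; have [x <-] := env_pi_surj u; rewrite env_mulE mul1r. Qed.
Lemma env_mulr1 : right_id env_one env_mul.
Proof. by move=> u; have [x <-] := env_pi_surj u; rewrite env_mulE mulr1. Qed.
Lemma env_mulDl : left_distributive env_mul +%R.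
Proof.
move=> u v w; have [x <-] := env_pi_surj u; have [y <-] := env_pi_surj v.
by have [z <-] := env_pi_surj w; rewrite -env_piD !env_mulE mulrDl env_piD.
Qed.
Lemma env_mulDr : right_distributive env_mul +%R.
Proof.
move=> u v w; have [x <-] := env_pi_surj u; have [y <-] := env_pi_surj v.
by have [z <-] := env_pi_surj w; rewrite -env_piD !env_mulE mulrDr env_piD.
Qed.
HB.instance Definition _ := GRing.Zmodule_isPzRing.Build env
  env_mulA env_mul1 env_mulr1 env_mulDl env_mulDr.

Lemma env_piM (a b : F) : env_pi (a * b) = env_pi a * env_pi b.
Proof. by rewrite -env_mulE. Qed.
Lemma env_pi1 : env_pi 1 = 1.
Proof. by []. Qed.

Lemma env_scalerAl (c : K) (u v : env) : c *: (u * v) = (c *: u) * v.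
Proof.
have [x <-] := env_pi_surj u; have [y <-] := env_pi_surj v.
by rewrite -env_piM -!env_piZ -env_piM scalerAl.
Qed.
Lemma env_scalerAr (c : K) (u v : env) : c *: (u * v) = u * (c *: v).
Proof.
have [x <-] := env_pi_surj u; have [y <-] := env_pi_surj v.
by rewrite -env_piM -!env_piZ -env_piM scalerAr.
Qed.

Local Notation whc := (word_hc gen_parity).

Lemma whc_gen k i x : whc k (env_gen i x) = if i == k then env_gen i x else 0.
Proof. by rewrite word_hcE /= addbF. Qed.

Lemma env_rel_homog k r : env_rel r -> whc k r = r \/ whc k r = 0.
Proof.
case=> [i a x y|i x|i j x y _ _].
- rewrite word_hc_sub word_hc_add word_hc_scale !whc_gen.
  by case: eqP; [left|right]; rewrite ?scaler0 ?addr0 ?subr0.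
- by rewrite word_hc_sub !whc_gen; case: eqP; [left|right]; rewrite ?subr0.
rewrite !word_hc_sub word_hc_scale whc_gen !free_wordM !word_hcE /word_parity /=.
rewrite !addbF (addbC j).
by case: eqP; [left|right]; rewrite ?scaler0 ?subr0.
Qed.

Lemma env_ideal_hc k f : env_ideal f -> env_ideal (whc k f).
Proof.
elim=> [|c u v [a [r [b [hr ->]]]] _ IH]; first by rewrite linear0; apply: lspan0.
rewrite linearP /=; apply: (smemP (s := env_ideal)) => //.
have hH a' b' l : env_ideal (a' * whc l r * b').
  apply: env_idealM; have [->|->] := env_rel_homog l hr; last exact: lspan0.
  exact: env_ideal_rel.
rewrite !word_hcM !mulrDl -!addrA.
by do 3![rewrite -[X in env_ideal (X + _)]scale1r; apply: (smemP (s := env_ideal)) => //].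
Qed.

Definition env_hc (i : bool) : env -> env := lquot_map env_ideal (whc i).
Lemma env_hcE i f : env_hc i (env_pi f) = env_pi (whc i f).
Proof.
apply: (lquot_mapE (f := whc i)); first exact: word_hc_linear.
by move=> v; apply: env_ideal_hc.
Qed.
Lemma env_hc_linear i : linear (env_hc i).
Proof.
apply: (lquot_map_linear (f := whc i)); first exact: word_hc_linear.
by move=> v; apply: env_ideal_hc.
Qed.
Lemma env_hcD u : env_hc false u + env_hc true u = u.
Proof. by have [f <-] := env_pi_surj u; rewrite !env_hcE -linearD word_hcD. Qed.
Lemma env_hcK i j u : env_hc i (env_hc j u) = if i == j then env_hc j u else 0.
Proof.
have [f <-] := env_pi_surj u; rewrite !env_hcE word_hcK.
by case: eqP => // _; rewrite linear0.
Qed.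
Definition env_space : superspace K := Superspace env_hc_linear env_hcD env_hcK.

Lemma env_hcM i u v : env_hc i (u * v) =
  env_hc false u * env_hc i v + env_hc true u * env_hc (~~ i) v.
Proof.
have [f <-] := env_pi_surj u; have [g <-] := env_pi_surj v.
by rewrite -env_piM !env_hcE -!env_piM -linearD word_hcM.
Qed.
Lemma env_hc1 i : env_hc i 1 = if i then 0 else 1.
Proof.
rewrite -env_pi1 env_hcE -[1]/(free_word K [::]) word_hcE /=.
by case: i; rewrite ?linear0.
Qed.

Definition env_in (x : L) : env := env_pi (env_gen false x + env_gen true x).

Lemma env_pi_rel r : env_rel r -> env_pi r = 0.
Proof.
by move=> hr; rewrite -(linear0 env_pi); apply/env_pi_eq; rewrite subr0; apply: env_ideal_rel.
Qed.
Lemma env_genP i a x y : env_pi (env_gen i (a *: x + y)) =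
  a *: env_pi (env_gen i x) + env_pi (env_gen i y).
Proof.
rewrite -env_piZ -env_piD; apply/env_pi_eq.
exact/env_ideal_rel/env_rel_linear.
Qed.
Lemma env_in_linear : linear env_in.
Proof.
move=> a x y; rewrite /env_in !env_piD !env_genP.
by rewrite scalerDr addrACA.
Qed.
HB.instance Definition _ := GRing.isLinear.Build K L env _ env_in env_in_linear.

Lemma env_gen_hc i j x :
  env_pi (env_gen i (hc j x)) = if i == j then env_pi (env_gen i x) else 0.
Proof.
have E k y : env_pi (env_gen k (hc k y)) = env_pi (env_gen k y).
  by apply/env_pi_eq/env_ideal_rel/env_rel_hc.
case: eqP => [<- //|/eqP ne]; rewrite -E hcK (negbTE ne).
by rewrite -[0](addNr 0) -scaleN1r env_genP scaleN1r addNr.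
Qed.
Lemma env_in_homog i x : homog i x -> env_in x = env_pi (env_gen i x).
Proof.
move=> <-; rewrite /env_in env_piD !env_gen_hc.
by case: i; rewrite ?addr0 ?add0r eqxx.
Qed.
Lemma env_hc_in i x : env_hc i (env_in x) = env_in (hc i x).
Proof.
rewrite (env_in_homog (homog_hc i x)) env_gen_hc eqxx.
rewrite /env_in env_hcE word_hc_add !whc_gen.
by case: i; rewrite ?addr0 ?add0r.
Qed.
Lemma env_in_br i j x y : homog i x -> homog j y ->
  env_in (br x y)
  = env_in x * env_in y - sgn K i j *: (env_in y * env_in x).
Proof.
move=> hx hy; rewrite (env_in_homog (br_homog hx hy)).
rewrite (env_in_homog hx) (env_in_homog hy) -!env_piM -linearZ_LR -linearB.
by apply/esym/env_pi_eq/env_ideal_rel/env_rel_br.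
Qed.
End Enveloping.

(* Ind_P^L N = U(L) (x)_{U(P)} N for a homomorphism j : P -> L: the quotient of
   the free module on U(L) x N by bilinearity and balancedness over P, which
   generates U(P). *)
Section Induction.
Variables (K : fieldType) (P L : lieSuperalgebra K) (j : lieHom P L).
Variable N : supermodule P.
Local Notation U := (env L).

Definition ind_sym : Type := (U * N)%type.
HB.instance Definition _ := Choice.on ind_sym.
Local Notation T := {malg K[ind_sym]}.

Fact ind_key : unit. Proof. by []. Qed.
Definition tsym : U -> N -> T :=
  locked_with ind_key (fun u n => << ((u, n) : ind_sym) >>).
Lemma tsymE u n : tsym u n = << ((u, n) : ind_sym) >>.
Proof. by rewrite /tsym unlock. Qed.

Inductive ind_rel : T -> Prop :=
| ind_rel_l a u u' n :
    ind_rel (tsym (a *: u + u') n - (a *: tsym u n + tsym u' n))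
| ind_rel_r a u n n' :
    ind_rel (tsym u (a *: n + n') - (a *: tsym u n + tsym u n'))
| ind_rel_bal u x n :
    ind_rel (tsym (u * env_in (j x)) n - tsym u (act x n)).

Definition ind : Type := lquot (lspan_subspace ind_rel).
HB.instance Definition _ := GRing.Lmodule.on ind.

Definition tens (u : U) (n : N) : ind := lpi (lspan_subspace ind_rel) (tsym u n).

Definition ind_lift (W : lmodType K) (h : U -> N -> W) : ind -> W :=
  lquot_lift (malg_ext (fun un : ind_sym => h un.1 un.2)).

Lemma tens_rel r : ind_rel r -> lpi (lspan_subspace ind_rel) r = 0.
Proof.
move=> hr; rewrite -lpi0; apply/lpi_eq; rewrite subr0 -[r]addr0 -[r]scale1r.
by apply: lspanZD => //; apply: lspan0.
Qed.
Lemma tens_linearl n : linear (tens^~ n).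
Proof.
move=> a u u'; apply/eqP; rewrite -subr_eq0; apply/eqP.
by rewrite /tens -linearP -linearB; apply: tens_rel; apply: ind_rel_l.
Qed.
Lemma tens_linearr u : linear (tens u).
Proof.
move=> a n n'; apply/eqP; rewrite -subr_eq0; apply/eqP.
by rewrite /tens -linearP -linearB; apply: tens_rel; apply: ind_rel_r.
Qed.
Lemma tens_bal u x n : tens (u * env_in (j x)) n = tens u (act x n).
Proof.
apply/eqP; rewrite -subr_eq0; apply/eqP.
by rewrite /tens -linearB; apply: tens_rel; apply: ind_rel_bal.
Qed.

Section Lift.
Variables (W : lmodType K) (h : U -> N -> W).
Hypothesis hl : forall n, linear (h^~ n).
Hypothesis hr : forall u, linear (h u).
Hypothesis hb : forall u x n, h (u * env_in (j x)) n = h u (act x n).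

Let H := malg_ext (fun un : ind_sym => h un.1 un.2).
Let H_lin : linear H. Proof. exact: malg_ext_linear. Qed.
Let H_ker v : lspan_subspace ind_rel v -> H v = 0.
Proof.
apply: lspan_ker => // r.
have HE u n : H (tsym u n) = h u n by rewrite tsymE; apply: malg_extU.
case=> [a u u' n|a u n n'|u x n]; rewrite (linear_sub H_lin) ?H_lin !HE.
- by have /= -> := hl n a u u'; rewrite subrr.
- by rewrite (hr u) subrr.
- by rewrite hb subrr.
Qed.

Lemma ind_liftE u n : ind_lift h (tens u n) = h u n.
Proof. by rewrite /ind_lift /tens lquot_liftE // tsymE; apply: malg_extU. Qed.
Lemma ind_lift_linear : linear (ind_lift h).
Proof. exact: lquot_lift_linear. Qed.
End Lift.

Lemma ind_lin_eq (W : lmodType K) (f g : ind -> W) : linear f -> linear g ->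
  (forall u n, f (tens u n) = g (tens u n)) -> f =1 g.
Proof.
move=> fl gl fg w; have [t <-] := lpi_surj w; move: t.
apply: malg_lin_eq => [a u v|a u v|[u n]]; last by rewrite -tsymE; apply: fg.
  by rewrite linearP; apply: fl.
by rewrite linearP; apply: gl.
Qed.

Definition ind_hc (i : bool) : ind -> ind := ind_lift (fun u n =>
  tens (env_hc false u) (hc i n) + tens (env_hc true u) (hc (~~ i) n)).

Lemma ind_hc_l i n : linear (fun u =>
  tens (env_hc false u) (hc i n) + tens (env_hc true u) (hc (~~ i) n)).
Proof.
move=> a u u'; rewrite !(env_hc_linear _ a u u') !(tens_linearl _ a).
by rewrite scalerDr addrACA.
Qed.
Lemma ind_hc_r i u : linear (fun n =>
  tens (env_hc false u) (hc i n) + tens (env_hc true u) (hc (~~ i) n)).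
Proof.
by move=> a n n'; rewrite !linearP !(tens_linearr _ a) scalerDr addrACA.
Qed.
Lemma ind_hc_b i u x n :
  tens (env_hc false (u * env_in (j x))) (hc i n)
    + tens (env_hc true (u * env_in (j x))) (hc (~~ i) n)
  = tens (env_hc false u) (hc i (act x n))
    + tens (env_hc true u) (hc (~~ i) (act x n)).
Proof.
rewrite !env_hcM !env_hc_in !lieHom_hc !(linear_add (@tens_linearl _)) !tens_bal.
rewrite !act_hc !(linear_add (@tens_linearr _)) /= negbK.
by rewrite addrACA; congr (_ + _); rewrite addrC.
Qed.
Lemma ind_hcE i u n : ind_hc i (tens u n) =
  tens (env_hc false u) (hc i n) + tens (env_hc true u) (hc (~~ i) n).
Proof. by apply: ind_liftE; [apply: ind_hc_l|apply: ind_hc_r|apply: ind_hc_b]. Qed.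
Lemma ind_hc_linear i : linear (ind_hc i).
Proof. by apply: ind_lift_linear; [apply: ind_hc_l|apply: ind_hc_r|apply: ind_hc_b]. Qed.

Lemma ind_hcD w : ind_hc false w + ind_hc true w = w.
Proof.
move: w; apply: (ind_lin_eq (g := idfun)) => [a u v|//|u n].
  by rewrite !ind_hc_linear scalerDr addrACA.
rewrite !ind_hcE /= addrACA [in X in _ + X]addrC.
rewrite -!(linear_add (@tens_linearr _)) hcD.
by rewrite -(linear_add (@tens_linearl _)) env_hcD.
Qed.
Lemma ind_hcK i k w : ind_hc i (ind_hc k w) = if i == k then ind_hc k w else 0.
Proof.
have t0 u : tens u 0 = 0.
  by rewrite -(scale0r 0) (linear_scale (@tens_linearr _)) scale0r.
have t0' n : tens 0 n = 0.
  by rewrite -(scale0r 0) (linear_scale (@tens_linearl _)) scale0r.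
move: w; apply: ind_lin_eq => [a u v|a u v|u n].
- by rewrite !ind_hc_linear.
- by case: eqP => _; rewrite ?ind_hc_linear // scaler0 addr0.
rewrite !ind_hcE (linear_add (@ind_hc_linear i)) !ind_hcE !env_hcK !hcK.
by case: i; case: k; rewrite /= ?t0 ?t0' ?addr0 ?add0r.
Qed.
Definition ind_space : superspace K := Superspace ind_hc_linear ind_hcD ind_hcK.

Definition ind_uact (u : U) : ind -> ind := ind_lift (fun u' n => tens (u * u') n).

Lemma ind_uact_l (u : U) n : linear (fun u' : U => tens (u * u') n).
Proof. by move=> a v v'; rewrite mulrDr -env_scalerAr tens_linearl. Qed.
Lemma ind_uact_r (u u' : U) : linear (fun n => tens (u * u') n).
Proof. exact: tens_linearr. Qed.
Lemma ind_uact_b (u u' : U) x n :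
  tens (u * (u' * env_in (j x))) n = tens (u * u') (act x n).
Proof. by rewrite mulrA tens_bal. Qed.
Lemma ind_uactE (u u' : U) n : ind_uact u (tens u' n) = tens (u * u') n.
Proof.
by apply: ind_liftE; [apply: ind_uact_l|apply: ind_uact_r|apply: ind_uact_b].
Qed.
Lemma ind_uact_linearr u : linear (ind_uact u).
Proof.
by apply: ind_lift_linear; [apply: ind_uact_l|apply: ind_uact_r|apply: ind_uact_b].
Qed.
Lemma ind_uact_linearl w : linear (ind_uact^~ w).
Proof.
move=> a u v /=; move: w; apply: ind_lin_eq => [b w w'|b w w'|u' n].
- exact: ind_uact_linearr.
- by rewrite !ind_uact_linearr !scalerDr !scalerA [a * b]mulrC addrACA.
by rewrite !ind_uactE mulrDl -env_scalerAl tens_linearl.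
Qed.
Lemma ind_uactM (u v : U) w : ind_uact (u * v) w = ind_uact u (ind_uact v w).
Proof.
move: w; apply: ind_lin_eq => [b w w'|b w w'|u' n].
- exact: ind_uact_linearr.
- by rewrite !ind_uact_linearr.
by rewrite !ind_uactE mulrA.
Qed.
Lemma ind_uact1 w : ind_uact 1 w = w.
Proof.
move: w; apply: (ind_lin_eq (g := idfun)) => [b w w'|//|u' n].
  exact: ind_uact_linearr.
by rewrite ind_uactE mul1r.
Qed.
Lemma ind_hc_uact i u w : ind_hc i (ind_uact u w) =
  ind_uact (env_hc false u) (ind_hc i w) + ind_uact (env_hc true u) (ind_hc (~~ i) w).
Proof.
move: w; apply: ind_lin_eq => [b w w'|b w w'|u' n].
- by rewrite ind_uact_linearr ind_hc_linear.
- by rewrite !ind_hc_linear !ind_uact_linearr scalerDr addrACA.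
rewrite !ind_uactE !ind_hcE !(linear_add (@ind_uact_linearr _)) !ind_uactE.
rewrite !env_hcM !(linear_add (@tens_linearl _)) negbK /=.
by rewrite addrACA; congr (_ + _); rewrite addrC.
Qed.

Definition ind_act (x : L) : ind -> ind := ind_uact (env_in x).

Lemma ind_act_linearl w : linear (ind_act^~ w).
Proof. by move=> a x y; rewrite /ind_act env_in_linear ind_uact_linearl. Qed.
Lemma ind_act_linearr x : linear (ind_act x).
Proof. exact: ind_uact_linearr. Qed.
Lemma ind_act_homog i k (x : L) (w : ind_space) :
  homog i x -> homog k w -> @homog K ind_space (i (+) k) (ind_act x w).
Proof.
move=> hx hw; rewrite /homog /= /ind_act ind_hc_uact !env_hc_in.
have z v : ind_uact (env_in 0) v = 0.
  rewrite -(scale0r 0) (linear_scale (@env_in_linear _ _)).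
  by rewrite (linear_scale (@ind_uact_linearl _)) scale0r.
rewrite -hx !hcK; case: i {hx} => /=; rewrite z ?addr0 ?add0r.
  by congr ind_uact; rewrite negbK; apply: hw.
by congr ind_uact; apply: hw.
Qed.
Lemma ind_act_br i k (x y : L) (w : ind_space) : homog i x -> homog k y ->
  ind_act (br x y) w = ind_act x (ind_act y w) - sgn K i k *: ind_act y (ind_act x w).
Proof.
move=> hx hy; rewrite /ind_act (env_in_br hx hy) (linear_sub (@ind_uact_linearl _)).
by rewrite (linear_scale (@ind_uact_linearl _)) !ind_uactM.
Qed.

Definition induced : supermodule L := @Supermodule K L ind_space ind_act
  ind_act_linearl ind_act_linearr ind_act_homog ind_act_br.

Lemma ind_uact0 w : ind_uact 0 w = 0.
Proof. by have := linear_scale (@ind_uact_linearl w) 0 0; rewrite !scale0r. Qed.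
Lemma ind_uactr0 u : ind_uact u 0 = 0.
Proof. by have := linear_scale (@ind_uact_linearr u) 0 0; rewrite !scale0r. Qed.

Lemma ind_uact_homog i k u v : ind_hc k v = v ->
  ind_hc i (ind_uact u v) = ind_uact (env_hc (i (+) k) u) v.
Proof.
move=> hv; have hv' : ind_hc (~~ k) v = 0 by rewrite -hv ind_hcK; case: k {hv}.
rewrite ind_hc_uact.
by case: i; case: k hv hv' => /= -> ->; rewrite ind_uactr0 ?addr0 ?add0r.
Qed.

Lemma ind_tens1_homog k n : homog k n -> ind_hc k (tens 1 n) = tens 1 n.
Proof.
have t0 m : tens 0 m = 0.
  by have := linear_scale (@tens_linearl m) 0 0; rewrite !scale0r.
by move=> hn; rewrite ind_hcE !env_hc1 t0 addr0 hn.
Qed.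

(* The subsupermodule U(L) v + c U(L) v' for homogeneous v and v'. *)
Section Usub.
Variables (c : K) (v v' : ind) (k k' : bool).
Definition usub_mem (w : ind) : Prop :=
  exists u u' : U, w = ind_uact u v + c *: ind_uact u' v'.
Lemma usub_mem0 : usub_mem 0.
Proof. by exists 0, 0; rewrite !ind_uact0 scaler0 addr0. Qed.
Lemma usub_memP a w w' : usub_mem w -> usub_mem w' -> usub_mem (a *: w + w').
Proof.
move=> [u1 [u2 ->]] [u1' [u2' ->]]; exists (a *: u1 + u1'), (a *: u2 + u2').
rewrite (ind_uact_linearl v a u1) (ind_uact_linearl v' a u2).
by rewrite !scalerDr !scalerA [a * c]mulrC addrACA.
Qed.
Lemma usub_act x w : usub_mem w -> usub_mem (ind_act x w).
Proof.
move=> [u [u' ->]]; exists (env_in x * u), (env_in x * u').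
rewrite (linear_add (@ind_act_linearr x)) (linear_scale (@ind_act_linearr x)).
by rewrite !ind_uactM.
Qed.
Lemma usub_hc (hv : ind_hc k v = v) (hv' : ind_hc k' v' = v') i w :
  usub_mem w -> usub_mem (ind_hc i w).
Proof.
move=> [u [u' ->]].
rewrite (linear_add (@ind_hc_linear i)) (linear_scale (@ind_hc_linear i)).
by rewrite (ind_uact_homog i u hv) (ind_uact_homog i u' hv'); do 2 eexists.
Qed.
Definition usub_space : subspace induced := @Subspace K induced usub_mem usub_mem0 usub_memP.
Definition usub (hv : ind_hc k v = v) (hv' : ind_hc k' v' = v') :
  subsupermodule induced :=
  @Subsupermodule K L induced usub_space (usub_hc hv hv') usub_act.
End Usub.
End Induction.


(* The basis e, f, h, p, q, z (even), E, F, G (odd) of the N = 1 super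
   Schroedinger algebra. *)
Inductive sgen := ge | gf | gh | gp | gq | gz | gE | gF | gG.

Definition sgens : seq sgen := [:: ge; gf; gh; gp; gq; gz; gE; gF; gG].
Definition sgen_code (g : sgen) : 'I_9 :=
  match g with
  | ge => inord 0 | gf => inord 1 | gh => inord 2 | gp => inord 3 | gq => inord 4
  | gz => inord 5 | gE => inord 6 | gF => inord 7 | gG => inord 8
  end.
Definition sgen_decode (i : 'I_9) : sgen := nth ge sgens i.
Lemma sgen_codeK : cancel sgen_code sgen_decode.
Proof. by case; rewrite /sgen_decode /= inordK. Qed.
HB.instance Definition _ := Countable.copy sgen (can_type sgen_codeK).
HB.instance Definition _ : isFinite sgen := CanIsFinite sgen_codeK.

Definition sgen_odd (g : sgen) : bool :=
  match g with gE | gF | gG => true | _ => false end.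

Definition sgen_eqb (a b : sgen) : bool :=
  match a, b with
  | ge, ge | gf, gf | gh, gh | gp, gp | gq, gq | gz, gz | gE, gE | gF, gF | gG, gG
    => true
  | _, _ => false
  end.
Lemma sgen_eqbE a b : (a == b) = sgen_eqb a b.
Proof. by apply/eqP/idP => [->|]; [case: b|case: a; case: b]. Qed.

(* [br_table a b = Some (c, g)] stands for [a, b] = c g. *)
Definition br_table (a b : sgen) : option (int * sgen) :=
  match a, b with
  | gh, ge => Some (2, ge)
  | gh, gf => Some (- 2, gf)
  | gh, gp => Some (1, gp)
  | gh, gq => Some (- 1, gq)
  | ge, gf => Some (1, gh)
  | gp, gq => Some (1, gz)
  | ge, gq => Some (1, gp)
  | gp, gf => Some (- 1, gq)
  | gh, gE => Some (1, gE)
  | gh, gF => Some (- 1, gF)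
  | ge, gF => Some (- 1, gE)
  | gf, gE => Some (- 1, gF)
  | gp, gF => Some (1, gG)
  | gq, gE => Some (1, gG)
  | gE, gE => Some (2, ge)
  | gF, gF => Some (- 2, gf)
  | gG, gG => Some (1, gz)
  | gE, gF => Some (1, gh)
  | gE, gG => Some (- 1, gp)
  | gF, gG => Some (1, gq)
  | _, _ => None
  end.

(* The coefficient of k in [a, b], super-antisymmetry filling in the pairs
   missing from the table. *)
Definition br_coef (a b k : sgen) : int :=
  match br_table a b, br_table b a with
  | Some (c, g), _ => if sgen_eqb g k then c else 0
  | None, Some (c, g) =>
      if sgen_eqb g k then (if sgen_odd a && sgen_odd b then c else - c) else 0
  | None, None => 0
  end.

Lemma br_coef_odd a b k :
  br_coef a b k != 0 -> sgen_odd k = sgen_odd a (+) sgen_odd b.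
Proof. by case: a; case: b; case: k. Qed.

Lemma br_coef_anti a b k :
  br_coef a b k = - ((-1) ^+ (sgen_odd a && sgen_odd b) * br_coef b a k).
Proof. by apply/eqP; case: a; case: b; case: k; vm_compute. Qed.

Lemma mem_sgens g : g \in sgens.
Proof. by rewrite /sgens !inE !sgen_eqbE; case: g. Qed.

Lemma big_sgen (R : nmodType) (F : sgen -> R) :
  \sum_g F g = F ge + (F gf + (F gh + (F gp + (F gq + (F gz +
               (F gE + (F gF + F gG))))))).
Proof.
have -> : \sum_g F g = \sum_(g <- sgens) F g.
  rewrite -big_enum /=; apply: perm_big; apply: uniq_perm => [||g].
  - exact: enum_uniq.
  - by rewrite /= !inE !sgen_eqbE.
  by rewrite mem_enum mem_sgens.
by rewrite /sgens !big_cons big_nil addr0.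
Qed.

Lemma br_coef_jacobi a b c k :
  \sum_m br_coef b c m * br_coef a m k =
  \sum_m br_coef a b m * br_coef m c k
  + (-1) ^+ (sgen_odd a && sgen_odd b) * \sum_m br_coef a c m * br_coef b m k.
Proof.
apply/eqP; rewrite !big_sgen.
move: k (mem_sgens k); apply/allP.
move: c (mem_sgens c); apply/allP.
move: b (mem_sgens b); apply/allP.
move: a (mem_sgens a); apply/allP.
by vm_compute.
Qed.

Section Schroedinger.
Variable K : fieldType.
Local Notation V := {ffun sgen -> K^o}.

Definition sbasis (g : sgen) : V := [ffun k => (k == g)%:R].

Definition schr_hc (i : bool) (x : V) : V :=
  [ffun k => if sgen_odd k == i then x k else 0].
Lemma schr_hc_linear i : linear (schr_hc i).
Proof.
by move=> a x y; apply/ffunP => k; rewrite !ffunE; case: eqP; rewrite ?scaler0 ?addr0.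
Qed.
Lemma schr_hcD x : schr_hc false x + schr_hc true x = x.
Proof.
by apply/ffunP => k; rewrite !ffunE; case: sgen_odd; rewrite ?addr0 ?add0r.
Qed.
Lemma schr_hcK i j x : schr_hc i (schr_hc j x) = if i == j then schr_hc j x else 0.
Proof.
apply/ffunP => k; rewrite !ffunE.
by case E: (sgen_odd k); case: i; case: j; rewrite /= !ffunE ?E.
Qed.
Definition schr_space : superspace K := Superspace schr_hc_linear schr_hcD schr_hcK.

Lemma schr_homog i (x : schr_space) a : homog i x -> sgen_odd a != i -> x a = 0.
Proof. by move=> <- /negbTE ne; rewrite ffunE ne. Qed.

Definition schr_br (x y : V) : V :=
  [ffun k => \sum_a \sum_b x a * y b * (br_coef a b k)%:~R].

Lemma schr_br_linearl y : linear (schr_br^~ y).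
Proof.
move=> c x x'; apply/ffunP => k; rewrite !ffunE scaler_sumr -big_split /=.
apply: eq_bigr => a _; rewrite scaler_sumr -big_split /=.
apply: eq_bigr => b _; rewrite !ffunE !mulrDl.
by congr (_ + _); rewrite /GRing.scale /= !mulrA.
Qed.
Lemma schr_br_linearr x : linear (schr_br x).
Proof.
move=> c y y'; apply/ffunP => k; rewrite !ffunE scaler_sumr -big_split /=.
apply: eq_bigr => a _; rewrite scaler_sumr -big_split /=.
apply: eq_bigr => b _; rewrite !ffunE mulrDr mulrDl.
by congr (_ + _); rewrite /GRing.scale /= !mulrA [x a * c]mulrC.
Qed.
Lemma schr_br_homog i j (x y : schr_space) : homog i x -> homog j y ->
  @homog K schr_space (i (+) j) (schr_br x y).
Proof.
move=> hx hy; apply/ffunP => k; rewrite !ffunE; case: eqP => // /eqP ne.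
apply/esym; rewrite big1 // => a _; rewrite big1 // => b _.
have [ea|/(schr_homog hx)->] := eqVneq (sgen_odd a) i; last by rewrite !mul0r.
have [eb|/(schr_homog hy)->] := eqVneq (sgen_odd b) j; last by rewrite mulr0 mul0r.
have [->|/br_coef_odd ek] := eqVneq (br_coef a b k) 0; first by rewrite mulr0.
by rewrite ek ea eb eqxx in ne.
Qed.
Lemma schr_br_anti i j (x y : schr_space) : homog i x -> homog j y ->
  schr_br x y = - (sgn K i j *: schr_br y x).
Proof.
move=> hx hy; apply/ffunP => k; rewrite !ffunE exchange_big scaler_sumr -sumrN.
apply: eq_bigr => b _; rewrite scaler_sumr -sumrN; apply: eq_bigr => a _.
have [ea|/(schr_homog hx)->] := eqVneq (sgen_odd a) i; last first.
  by rewrite mulr0 !mul0r scaler0 oppr0.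
have [eb|/(schr_homog hy)->] := eqVneq (sgen_odd b) j; last first.
  by rewrite mulr0 !mul0r scaler0 oppr0.
rewrite br_coef_anti ea eb rmorphN rmorphM rmorphXn rmorphN1 mulrN /sgn.
by rewrite mulrCA [x a * _]mulrC.
Qed.

Let tri (x y z : V) (J : sgen -> sgen -> sgen -> int) : K :=
  \sum_a \sum_b \sum_c x a * y b * z c * (J a b c)%:~R.

Let schr_brr x y z k : schr_br x (schr_br y z) k =
  tri x y z (fun a b c => \sum_m br_coef b c m * br_coef a m k).
Proof.
rewrite ffunE; apply: eq_bigr => a _.
under eq_bigr => m _.
  rewrite ffunE mulr_sumr mulr_suml.
  under eq_bigr => b _ do rewrite mulr_sumr mulr_suml.
  over.
rewrite exchange_big /=; apply: eq_bigr => b _.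
rewrite exchange_big /=; apply: eq_bigr => c _.
rewrite rmorph_sum mulr_sumr; apply: eq_bigr => m _.
by rewrite rmorphM !mulrA.
Qed.
Let schr_brl x y z k : schr_br (schr_br x y) z k =
  tri x y z (fun a b c => \sum_m br_coef a b m * br_coef m c k).
Proof.
rewrite ffunE.
under eq_bigr => m _.
  under eq_bigr => c _.
    rewrite ffunE !mulr_suml.
    under eq_bigr => a _ do rewrite !mulr_suml.
    over.
  rewrite exchange_big /=.
  under eq_bigr => a _ do rewrite exchange_big /=.
  over.
rewrite exchange_big /=; apply: eq_bigr => a _.
rewrite exchange_big /=; apply: eq_bigr => b _.
rewrite exchange_big /=; apply: eq_bigr => c _.
rewrite rmorph_sum mulr_sumr; apply: eq_bigr => m _.
by rewrite rmorphM !mulrA; congr (_ * _); rewrite mulrAC.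
Qed.

Lemma schr_br_jacobi i j (x y z : schr_space) : homog i x -> homog j y ->
  schr_br x (schr_br y z) =
  schr_br (schr_br x y) z + sgn K i j *: schr_br y (schr_br x z).
Proof.
move=> hx hy; apply/ffunP => k; rewrite [RHS]ffunE [X in _ + X]ffunE !schr_brr schr_brl.
have -> : tri y x z (fun a b c => \sum_m br_coef b c m * br_coef a m k) =
    tri x y z (fun a b c => \sum_m br_coef a c m * br_coef b m k).
  rewrite /tri exchange_big; apply: eq_bigr => a _; apply: eq_bigr => b _.
  by apply: eq_bigr => c _; rewrite [y b * _]mulrC.
rewrite /tri scaler_sumr -big_split; apply: eq_bigr => a _.
rewrite scaler_sumr -big_split; apply: eq_bigr => b _.
rewrite scaler_sumr -big_split; apply: eq_bigr => c _ /=.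
have [ea|/(schr_homog hx)->] := eqVneq (sgen_odd a) i; last first.
  by rewrite !mul0r scaler0 addr0.
have [eb|/(schr_homog hy)->] := eqVneq (sgen_odd b) j; last first.
  by rewrite mulr0 !mul0r scaler0 addr0.
rewrite br_coef_jacobi ea eb rmorphD rmorphM rmorphXn rmorphN1 mulrDr.
by congr (_ + _); rewrite mulrCA.
Qed.

Definition schr : lieSuperalgebra K := @LieSuperalgebra K schr_space schr_br
  schr_br_linearl schr_br_linearr schr_br_homog schr_br_anti schr_br_jacobi.

(* The ideal p = Span{p, q, z, G}, made into the Lie superalgebra [schr_p] below. *)
Definition pp : {vspace V} := <<[:: sbasis gp; sbasis gq; sbasis gz; sbasis gG]>>%VS.

Definition in_p (g : sgen) : bool :=
  match g with gp | gq | gz | gG => true | _ => false end.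

Lemma schr_expand (x : V) : x = \sum_g x g *: sbasis g.
Proof.
apply/ffunP => k; rewrite sum_ffunE (bigD1 k) //= !ffunE eqxx.
rewrite big1 ?addr0 ?[_ *: _]mulr1 // => g ne.
by rewrite !ffunE eq_sym (negbTE ne) scaler0.
Qed.

Lemma sbasis_pp g : in_p g -> sbasis g \in pp.
Proof.
by case: g => // _; apply: memv_span; rewrite !inE eqxx ?orbT.
Qed.

Lemma ppP (x : V) : reflect (forall g, ~~ in_p g -> x g = 0) (x \in pp).
Proof.
apply: (iffP idP) => [xp g ng|x0].
  rewrite (coord_span xp) sum_ffunE big1 // => -[[|[|[|[|//]]]] lt4] _ /=;
    by rewrite !ffunE sgen_eqbE; case: g ng => //= _; rewrite scaler0.
rewrite (schr_expand x); apply: memv_suml => g _.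
case: (boolP (in_p g)) => [/sbasis_pp/memvZ-> //|/x0->].
by rewrite scale0r mem0v.
Qed.

Lemma pp_hc i (x : schr_space) : x \in pp -> hc i x \in pp.
Proof.
by move=> /ppP x0; apply/ppP => g /x0 E; rewrite ffunE E if_same.
Qed.
Lemma pp_ideal (x y : schr) : y \in pp -> br x y \in pp.
Proof.
move=> /ppP y0; apply/ppP => k nk; rewrite ffunE big1 // => a _; rewrite big1 // => b _.
case: (boolP (in_p b)) => [pb|/y0->]; last by rewrite mulr0 mul0r.
have -> : br_coef a b k = 0 by case: a; case: b pb => //; case: k nk.
by rewrite mulr0.
Qed.

Local Notation P := (subvs_of pp).
Let vsvalZ a (x : P) : vsval (a *: x) = a *: vsval x.
Proof. exact: linearZ_LR. Qed.
Let vsvalN (x : P) : vsval (- x) = - vsval x.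
Proof. exact: linearN. Qed.
Let vsvalD (x y : P) : vsval (x + y) = vsval x + vsval y.
Proof. exact: linearD. Qed.
Let vsvalP a (x y : P) : vsval (a *: x + y) = a *: vsval x + vsval y.
Proof. exact: linearP. Qed.
Definition p_hc (i : bool) (x : P) : P := vsproj pp (@hc K schr i (vsval x)).
Lemma p_hcE i x : vsval (p_hc i x) = @hc K schr i (vsval x).
Proof. by rewrite vsprojK // pp_hc // subvsP. Qed.
Lemma p_hc_linear i : linear (p_hc i).
Proof.
move=> a x y; apply/val_inj.
by rewrite [LHS]p_hcE [RHS]vsvalP vsvalP !p_hcE; apply: (@hc_linear K schr i).
Qed.
Lemma p_hcD x : p_hc false x + p_hc true x = x.
Proof. by apply/val_inj; rewrite -[p_hc false x]scale1r [LHS]vsvalP scale1r !p_hcE; apply: (@hcD K schr). Qed.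
Lemma p_hcK i j x : p_hc i (p_hc j x) = if i == j then p_hc j x else 0.
Proof.
apply/val_inj; rewrite [LHS]p_hcE p_hcE hcK.
case: eqP => _; first by rewrite [RHS]p_hcE.
by rewrite [RHS]linear0.
Qed.
Definition p_space : superspace K := Superspace p_hc_linear p_hcD p_hcK.

Lemma p_homog i (x : p_space) : homog i x <-> @homog K schr i (vsval x).
Proof.
split=> [<-|h]; first by rewrite /homog [vsval _]p_hcE hcK eqxx.
by apply/val_inj; rewrite [LHS]p_hcE.
Qed.

Definition p_br (x y : P) : P := vsproj pp (@br K schr (vsval x) (vsval y)).
Lemma p_brE x y : vsval (p_br x y) = @br K schr (vsval x) (vsval y).
Proof. by rewrite vsprojK // pp_ideal // subvsP. Qed.
Lemma p_br_linearl y : linear (p_br^~ y).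
Proof.
move=> a x x'; apply/val_inj.
rewrite [LHS]p_brE [RHS]vsvalP vsvalP !p_brE; apply: (@br_linearl K schr).
Qed.
Lemma p_br_linearr x : linear (p_br x).
Proof.
move=> a y y'; apply/val_inj.
rewrite [LHS]p_brE [RHS]vsvalP vsvalP !p_brE; apply: (@br_linearr K schr).
Qed.
Lemma p_br_homog i j (x y : p_space) : homog i x -> homog j y ->
  @homog K p_space (i (+) j) (p_br x y).
Proof.
move=> /p_homog hx /p_homog hy; apply/p_homog; rewrite p_brE.
exact: br_homog.
Qed.
Lemma p_br_anti i j (x y : p_space) : homog i x -> homog j y ->
  p_br x y = - (sgn K i j *: p_br y x).
Proof.
move=> /p_homog hx /p_homog hy; apply/val_inj; rewrite [LHS]p_brE.
rewrite [RHS]vsvalN [X in - X]vsvalZ p_brE.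
exact: (@br_anti K schr _ _ _ _ hx hy).
Qed.
Lemma p_br_jacobi i j (x y z : p_space) : homog i x -> homog j y ->
  p_br x (p_br y z) = p_br (p_br x y) z + sgn K i j *: p_br y (p_br x z).
Proof.
move=> /p_homog hx /p_homog hy; apply/val_inj; rewrite [LHS]p_brE p_brE.
rewrite [RHS]vsvalD [X in _ + X]vsvalZ !p_brE.
exact: (@br_jacobi K schr _ _ _ _ _ hx hy).
Qed.
Definition schr_p : lieSuperalgebra K := @LieSuperalgebra K p_space p_br
  p_br_linearl p_br_linearr p_br_homog p_br_anti p_br_jacobi.

Lemma p_incl_linear : linear (fun x : schr_p => vsval (x : P) : schr).
Proof. exact: vsvalP. Qed.
Lemma p_incl_homog i (x : schr_p) : homog i x -> @homog K schr i (vsval (x : P)).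
Proof. by move=> /p_homog. Qed.
Definition p_incl : lieHom schr_p schr :=
  @LieHom K schr_p schr (fun x => vsval (x : P)) p_incl_linear p_incl_homog p_brE.

Definition p_elt (g : sgen) : schr_p := vsproj pp (sbasis g).
End Schroedinger.

Section Whittaker.
Variable K : fieldType.

Definition base_hc (i : bool) (v : K^o) : K^o := if i then 0 else v.
Lemma base_hc_linear i : linear (base_hc i).
Proof. by case: i => a u v //=; rewrite scaler0 addr0. Qed.
Lemma base_hcD v : base_hc false v + base_hc true v = v.
Proof. exact: addr0. Qed.
Lemma base_hcK i j v : base_hc i (base_hc j v) = if i == j then base_hc j v else 0.
Proof. by case: i; case: j. Qed.
Definition base_space : superspace K := Superspace base_hc_linear base_hcD base_hcK.

(* K as a purely even abelian Lie superalgebra. *)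
Definition base_br (x y : base_space) : base_space := 0.
Lemma base_br_linear (x : base_space) : linear (base_br x).
Proof. by move=> a u v; rewrite scaler0 addr0. Qed.
Lemma base_br_homog i j (x y : base_space) : homog i x -> homog j y ->
  homog (i (+) j) (base_br x y).
Proof. by move=> _ _; rewrite /homog linear0. Qed.
Lemma base_br_anti i j (x y : base_space) : homog i x -> homog j y ->
  base_br x y = - (sgn K i j *: base_br y x).
Proof. by move=> _ _; rewrite scaler0 oppr0. Qed.
Lemma base_br_jacobi i j (x y z : base_space) : homog i x -> homog j y ->
  base_br x (base_br y z) =
  base_br (base_br x y) z + sgn K i j *: base_br y (base_br x z).
Proof. by move=> _ _; rewrite scaler0 addr0. Qed.
Definition base_lie : lieSuperalgebra K := @LieSuperalgebra K base_space base_br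
  base_br_linear base_br_linear base_br_homog base_br_anti base_br_jacobi.

Variable phi : lieHom (schr_p K) (base_lie).

Definition Cw_act (x : schr_p K) (v : base_space) : base_space :=
  (phi x : K) *: (v : K^o).
Lemma Cw_act_linearl v : linear (Cw_act^~ v).
Proof.
move=> a x y; rewrite /Cw_act (@lh_linear _ _ _ phi a x y).
by rewrite scalerDl scalerA.
Qed.
Lemma Cw_act_linearr x : linear (Cw_act x).
Proof. by move=> a u v; rewrite /Cw_act scalerDr !scalerA mulrC. Qed.
Lemma phi_odd x : homog true x -> phi x = 0.
Proof. by move=> hx; rewrite -(@lh_homog _ _ _ phi _ _ hx). Qed.
Lemma Cw_act_homog i j (x : schr_p K) (v : base_space) :
  homog i x -> homog j v -> homog (i (+) j) (Cw_act x v).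
Proof.
case: i => [/phi_odd hx _|_ hv]; first by rewrite /Cw_act hx scale0r /homog linear0.
by rewrite /homog /Cw_act linearZ_LR; congr (_ *: _); apply: hv.
Qed.
Lemma Cw_act_br i j (x y : schr_p K) (v : base_space) : homog i x -> homog j y ->
  Cw_act (br x y) v =
  Cw_act x (Cw_act y v) - sgn K i j *: Cw_act y (Cw_act x v).
Proof.
move=> hx hy; rewrite /Cw_act lh_br scale0r /sgn.
case: i hx => [/phi_odd->|_]; first by rewrite !scale0r !scaler0 subr0.
by rewrite scale1r !scalerA mulrC subrr.
Qed.
Definition Cw : supermodule (schr_p K) := @Supermodule K (schr_p K) base_space Cw_act
  Cw_act_linearl Cw_act_linearr Cw_act_homog Cw_act_br.

(* v lies in V_phi. *)
Definition whittaker_vector (V : supermodule (schr K)) (v : V) : Prop :=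
  forall x : schr_p K, act (p_incl K x) v = (phi x : K) *: v.

Definition quasi_whittaker (V : supermodule (schr K)) : Prop :=
  exists (i : bool) (v : V), [/\ homog i v, whittaker_vector v & generated_by v].

Definition W : supermodule (schr K) := induced (p_incl K) Cw.

Definition w_phi : W := tens (p_incl K) (N := Cw) 1 (1 : K^o).

Definition phi_at (g : sgen) : K := phi (p_elt K g).

Definition y0 : schr K :=
  phi_at gq ^+ 2 *: sbasis K ge + (phi_at gp * phi_at gq) *: sbasis K gh
  - phi_at gp ^+ 2 *: sbasis K gf.
Definition y1 : schr K := phi_at gq *: sbasis K gE + phi_at gp *: sbasis K gF.

Lemma w_phi_even : ind_hc false w_phi = w_phi.
Proof. exact: ind_tens1_homog. Qed.

Lemma sbasis_homog g : @homog K (schr K) (sgen_odd g) (sbasis K g).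
Proof.
apply/ffunP => k; rewrite !ffunE; case: eqP => // ne.
by case: eqP => // E; rewrite E in ne.
Qed.
Lemma y0_even : hc false y0 = y0.
Proof.
rewrite /y0 (linear_sub (@hc_linear _ (schr K) _)) (linear_add (@hc_linear _ (schr K) _)).
rewrite !(linear_scale (@hc_linear _ (schr K) _)).
have E g : ~~ sgen_odd g -> @hc K (schr K) false (sbasis K g) = sbasis K g.
  by move/negbTE=> <-; apply: sbasis_homog.
by rewrite !E.
Qed.
Lemma y1_odd : hc true y1 = y1.
Proof.
rewrite /y1 (linear_add (@hc_linear _ (schr K) _)) !(linear_scale (@hc_linear _ (schr K) _)).
by congr (_ *: _ + _ *: _); [apply: (sbasis_homog gE)|apply: (sbasis_homog gF)].
Qed.

Definition y0_w (xi : K) : W := ind_uact (env_in y0 - xi *: (1 : env (schr K))) w_phi.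
Definition y1_w : W := ind_uact (env_in y1) w_phi.

Lemma y0_w_even xi : ind_hc false (y0_w xi) = y0_w xi.
Proof.
rewrite (ind_uact_homog false _ w_phi_even) /= (linear_sub (@env_hc_linear _ _ _)).
by rewrite (linear_scale (@env_hc_linear _ _ _)) env_hc_in y0_even env_hc1.
Qed.
Lemma y1_w_odd : ind_hc true y1_w = y1_w.
Proof. by rewrite (ind_uact_homog true _ w_phi_even) /= env_hc_in y1_odd. Qed.

Definition L_xi (xi : K) : supermodule (schr K) :=
  quot_supermodule (usub (0 == xi)%:R (y0_w_even xi) y1_w_odd).
End Whittaker.

(* Main.v *)
Require Import Defs.
From HB Require Import structures.
From mathcomp Require Import all_boot all_order all_algebra.
From mathcomp Require Import boolp reals complex ring.

(* Let V be generated by a homogeneous w in V_phi. Since y1^2 = y0 and y1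
   preserves V_phi, the span M of the y1^j w lies in V_phi. Filter V by
   Fil k = words of length < k in the algebra applied to M. For t in the ideal p,
   t - phi(t) maps Fil (k+1) to Fil k, and the Euler operator
   A_p (p - phi p) + A_q (q - phi q) + A_G G, where A_p, A_q, A_G are dual to
   p, q, G for the pairing phi([t, x]), acts on Fil (k+1) as k modulo Fil k. It
   kills Whittaker vectors, so V_phi = M. Moreover every nonzero submodule meets
   V_phi, namely in the lowest step of the filtration that it meets. So no PBW
   basis of W(phi) is needed.

   If V is irreducible and y0 w <> 0, then y0 w generates V as well, hence w is a
   combination of the y1^j y0 w: a nonzero polynomial in y1 kills w, and y1 has an
   eigenvector in V_phi. This yields xi with y0 = xi on V_phi. When xi = 0, the
   vector y1 w vanishes, since otherwise V_phi would be spanned by y1 w, whose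
   parity differs from that of w. Conversely, these relations and V_phi = M show
   that L_xi has no nonzero proper submodule, so the map L_xi -> V is bijective. *)

Set Implicit Arguments.
Unset Strict Implicit.
Unset Printing Implicit Defensive.

Import GRing.Theory.
Local Open Scope ring_scope.

(** * Subspaces and linear maps *)

Lemma lspan_sub (K : fieldType) (V : lmodType K) (A : V -> Prop) (N : subspace V) :
  (forall u, A u -> N u) -> forall u, lspan A u -> N u.
Proof.
by move=> AN u; elim=> [|a x y /AN Nx _ IH]; [apply: smem0|apply: smemP].
Qed.

Lemma lspan_gen (K : fieldType) (V : lmodType K) (A : V -> Prop) u :
  A u -> lspan A u.
Proof.
by move=> Au; rewrite -[u]addr0 -[u]scale1r; apply: lspanZD => //; apply: lspan0.
Qed.

Section SubspaceTheory.
Variables (K : fieldType) (V : lmodType K) (N : subspace V).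

Lemma smemD u v : N u -> N v -> N (u + v).
Proof. by move=> Nu Nv; rewrite -[u]scale1r; apply: smemP. Qed.

Lemma smemN u : N u -> N (- u).
Proof. by rewrite -scaleN1r; apply: smemZ. Qed.

Lemma smemB u v : N u -> N v -> N (u - v).
Proof. by move=> Nu /smemN; apply: smemD. Qed.

End SubspaceTheory.

Lemma linear_zero (K : fieldType) (V V' : lmodType K) (f : V -> V') :
  linear f -> f 0 = 0.
Proof. by move=> fl; rewrite -(scale0r 0) (linear_scale fl) scale0r. Qed.

Section PreimageSubspace.
Variables (K : fieldType) (V V' : lmodType K) (f : V -> V') (f_lin : linear f).
Variable N : subspace V'.

Lemma preim_subspace0 : N (f 0).
Proof. by rewrite (linear_zero f_lin); apply: smem0. Qed.

Lemma preim_subspaceP a u v : N (f u) -> N (f v) -> N (f (a *: u + v)).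
Proof. by rewrite f_lin; apply: smemP. Qed.

Definition preim_subspace : subspace V :=
  Subspace preim_subspace0 preim_subspaceP.

End PreimageSubspace.

(** * Identities in supermodules *)

Section SupermoduleTheory.
Variables (K : fieldType) (L : lieSuperalgebra K) (V : supermodule L).
Implicit Types (x y : L) (u v : V).

Lemma actDl x y v : act (x + y) v = act x v + act y v.
Proof. exact: linear_add (act_linearl v) x y. Qed.
Lemma actZl a x v : act (a *: x) v = a *: act x v.
Proof. exact: linear_scale (act_linearl v) a x. Qed.
Lemma actDr x u v : act x (u + v) = act x u + act x v.
Proof. exact: linear_add (act_linearr x) u v. Qed.
Lemma actBr x u v : act x (u - v) = act x u - act x v.
Proof. exact: linear_sub (act_linearr x) u v. Qed.
Lemma actZr a x v : act x (a *: v) = a *: act x v.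
Proof. exact: linear_scale (act_linearr x) a v. Qed.
Lemma act0r x : act x (0 : V) = 0.
Proof. exact: linear_zero (act_linearr x). Qed.

Lemma act_comm i j x y v : homog i x -> homog j y ->
  act x (act y v) = act (br x y) v + sgn K i j *: act y (act x v).
Proof. by move=> hx hy; rewrite (act_br v hx hy) subrK. Qed.

Lemma act_hcD x v : act x v = act (hc false x) v + act (hc true x) v.
Proof. by rewrite -actDl hcD. Qed.

Lemma hc_act_homog i k x v : homog i x -> hc k (act x v) = act x (hc (k (+) i) v).
Proof.
move=> hx; rewrite act_hc -hx !hcK.
by case: i {hx}; case: k; rewrite /= -[in act 0 _](scale0r 0) actZl scale0r ?add0r ?addr0.
Qed.

Lemma homog_hcN i v : homog i v -> hc (~~ i) v = 0.
Proof. by move=> <-; rewrite hcK; case: i. Qed.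

Lemma homog_diff i v : homog i v -> homog (~~ i) v -> v = 0.
Proof. by move=> /homog_hcN E; rewrite /homog E. Qed.

End SupermoduleTheory.

(** * Signs, and the extension of [phi] to the whole algebra *)

Lemma sgnK (K : fieldType) i j : sgn K i j * sgn K i j = 1.
Proof. by case: i; case: j; rewrite /sgn /= ?expr1 ?expr0 ?mulr1 // mulrNN mulr1. Qed.

(* The functional x |-> x_p phi(p) + x_q phi(q) on the whole algebra extends phi,
   because phi(z) = phi([p, q]) = 0 and phi(G) = 0. *)
Section Functional.
Variables (K : fieldType) (phi : lieHom (schr_p K) (base_lie K)).
Local Notation a := (phi_at phi gp).
Local Notation b := (phi_at phi gq).

Definition phi_ext (x : schr K) : K := (x gp : K) * a + (x gq : K) * b.

Local Notation pe := phi_ext.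

Lemma phi_ext_linear c (x y : schr K) : phi_ext (c *: x + y) = c * phi_ext x + phi_ext y.
Proof.
by rewrite /phi_ext !ffunE !mulrDl mulrDr addrACA !mulrA.
Qed.

Lemma br_sbasis (g g' : sgen) k :
  (@br K (schr K) (sbasis K g) (sbasis K g')) k = (br_coef g g' k)%:~R.
Proof.
rewrite ffunE (bigD1 g) //= (bigD1 g') //= !ffunE !eqxx !mul1r.
rewrite big1 => [|h ne]; last by rewrite !ffunE (negbTE ne) mulr0 mul0r.
rewrite big1 ?addr0 => [//|h ne]; rewrite big1 // => l _.
by rewrite !ffunE (negbTE ne) !mul0r.
Qed.

Lemma p_eltE g : in_p g -> vsval (p_elt K g) = sbasis K g.
Proof. by move=> pg; rewrite vsprojK // sbasis_pp. Qed.

Lemma phi_at_z : phi_at phi gz = 0.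
Proof.
rewrite /phi_at; have -> : p_elt K gz = br (p_elt K gp) (p_elt K gq).
  apply/val_inj; rewrite [RHS]p_brE [LHS]p_eltE // !p_eltE //.
  by apply/ffunP => k; rewrite br_sbasis !ffunE sgen_eqbE; case: k.
by rewrite lh_br.
Qed.

Lemma phi_at_G : phi_at phi gG = 0.
Proof.
apply: phi_odd; apply/p_homog; rewrite p_eltE //.
exact: (sbasis_homog K gG).
Qed.

Lemma phi_extE (t : schr_p K) : phi t = phi_ext (p_incl K t) :> K.
Proof.
have /ppP t0 := subvsP t.
have {1}-> : t = \sum_(g <- [:: gp; gq; gz; gG]) (p_incl K t : schr K) g *: p_elt K g.
  apply/val_inj; rewrite /= !big_cons big_nil addr0.
  apply/ffunP => k; rewrite !linearD !linearZ /= !p_eltE // !ffunE !sgen_eqbE.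
  have := t0 k; case: k => /=; rewrite ?[_ *: 0]mulr0 ?[_ *: 1]mulr1 ?add0r ?addr0 //;
  by move=> ->.
rewrite !big_cons big_nil addr0 !(linear_add (@lh_linear _ _ _ phi)).
rewrite !(linear_scale (@lh_linear _ _ _ phi)) -!/(phi_at phi _) phi_at_z phi_at_G.
by rewrite !scaler0 !addr0.
Qed.

Lemma phi_ext_odd t : homog true t -> phi_ext t = 0.
Proof.
by move=> ht; rewrite /phi_ext !(@schr_homog _ _ _ _ ht) // !mul0r addr0.
Qed.

(** Signs matter only for odd [t], where [phi_ext] vanishes. Hence subtracting the scalar
    [phi_ext t] from the action of [t] brings no extra sign into commutation formulas. *)
Lemma sgn_phi_ext i j t : homog i t -> sgn K i j * phi_ext t = phi_ext t.
Proof.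
case: i => [/phi_ext_odd->|_]; first by rewrite mulr0.
by rewrite mul1r.
Qed.

Lemma pp_br t x : t \in pp K -> @br K (schr K) t x \in pp K.
Proof.
move=> /ppP t0; apply/ppP => k nk; rewrite ffunE big1 // => c _; rewrite big1 // => d _.
case: (boolP (in_p c)) => [pc|/t0->]; last by rewrite !mul0r.
have -> : br_coef c d k = 0 by case: c pc => //; case: d => //; case: k nk.
by rewrite mulr0.
Qed.

Lemma br_sbasisl g (x : schr K) k :
  (@br K (schr K) (sbasis K g) x) k = \sum_h (x h : K) * (br_coef g h k)%:~R.
Proof.
rewrite ffunE (bigD1 g) //= [X in _ + X]big1 ?addr0 => [|h ne].
  by apply: eq_bigr => h _; rewrite ffunE eqxx mul1r.
by rewrite big1 // => l _; rewrite ffunE (negbTE ne) !mul0r.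
Qed.

Lemma br_sbasisr g (x : schr K) k :
  (@br K (schr K) x (sbasis K g)) k = \sum_h (x h : K) * (br_coef h g k)%:~R.
Proof.
rewrite ffunE; apply: eq_bigr => h _; rewrite (bigD1 g) //= ffunE eqxx mulr1.
by rewrite big1 ?addr0 // => l ne; rewrite ffunE (negbTE ne) mulr0 mul0r.
Qed.

Lemma phi_br_p (x : schr K) :
  pe (@br K (schr K) (sbasis K gp) x) = - a * (x gh : K) - b * (x gf : K).
Proof.
rewrite /phi_ext !br_sbasisl !big_sgen /=.
by rewrite ?mulr0z ?mulr1z ?mulrN1z ?mulr0 ?add0r ?addr0; ring.
Qed.

Lemma phi_br_q (x : schr K) :
  pe (@br K (schr K) (sbasis K gq) x) = b * (x gh : K) - a * (x ge : K).
Proof.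
rewrite /phi_ext !br_sbasisl !big_sgen /=.
by rewrite ?mulr0z ?mulr1z ?mulrN1z ?mulr0 ?add0r ?addr0; ring.
Qed.

Lemma phi_br_G (x : schr K) :
  pe (@br K (schr K) (sbasis K gG) x) = b * (x gF : K) - a * (x gE : K).
Proof.
rewrite /phi_ext !br_sbasisl !big_sgen /=.
by rewrite ?mulr0z ?mulr1z ?mulrN1z ?mulr0 ?add0r ?addr0; ring.
Qed.

Lemma phi_extZ c x : pe (c *: x) = c * pe x.
Proof. by rewrite /phi_ext !ffunE mulrDr !mulrA. Qed.

(** [y1] stabilises the character: its brackets with [p], [q] and [z] are odd or zero, and in the
    bracket with [G] the contributions of [E] and [F] cancel. *)
Lemma phi_br_y1 t : t \in pp K -> pe (@br K (schr K) t (y1 phi)) = 0.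
Proof.
move=> /ppP t0.
rewrite /y1 br_linearr (linear_scale (@br_linearr _ (schr K) t)) phi_ext_linear.
rewrite phi_extZ /phi_ext !br_sbasisr !big_sgen /= (t0 ge) // (t0 gf) // (t0 gh) //.
by rewrite (t0 gE) // (t0 gF) // ?mulr0z ?mulr1z ?mulrN1z ?mulr0 ?mul0r ?add0r ?addr0; ring.
Qed.

Lemma schrD (x y : schr K) k : (x + y) k = (x k : K) + (y k : K).
Proof. by rewrite ffunE. Qed.
Lemma schrZ c (x : schr K) k : (c *: x) k = c * (x k : K).
Proof. by rewrite ffunE. Qed.

Lemma br_y1_y1 : @br K (schr K) (y1 phi) (y1 phi) = 2%:R *: y0 phi.
Proof.
apply/ffunP => k; rewrite {1}/y1 (@br_linearl _ (schr K)).
rewrite (linear_scale (@br_linearl _ (schr K) _)) schrD !schrZ !br_sbasisl !big_sgen.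
rewrite /y1 /y0 !ffunE !sgen_eqbE /GRing.scale /=.
have FF : br_coef gF gF gf = - 2 by [].
by case: k => /=; rewrite ?FF ?mulrNz ?mulr0z ?mulr1z; ring.
Qed.

Lemma y0_homog : @homog K (schr K) false (y0 phi).
Proof. exact: y0_even. Qed.
Lemma y1_homog : @homog K (schr K) true (y1 phi).
Proof. exact: y1_odd. Qed.

Lemma homogZD (L : superspace K) i c (x y : L) : homog i x -> homog i y ->
  homog i (c *: x + y).
Proof. by rewrite /homog hc_linear => -> ->. Qed.

(* Ap, Aq, AG form a basis of osp(1|2) modulo (y0, y1) dual to p, q, G for the
   pairing (t, x) |-> phi([t, x]). *)
Definition dual_basis (Ap Aq AG : schr K) : Prop :=
  [/\ homog false Ap, homog false Aq, homog true AG &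
   (forall x : schr K, exists (c0 c1 : K) (t : schr K), t \in pp K /\
     x = pe (@br K (schr K) (sbasis K gp) x) *: Ap
       + (pe (@br K (schr K) (sbasis K gq) x) *: Aq
       + (pe (@br K (schr K) (sbasis K gG) x) *: AG
       + (c0 *: y0 phi + (c1 *: y1 phi + t)))))].

Lemma dual_basis_exists : a != 0 \/ b != 0 ->
  exists Ap Aq AG, dual_basis Ap Aq AG.
Proof.
pose tail (x : schr K) : schr K := [ffun k => if in_p k then x k else 0].
have tailP x : tail x \in pp K by apply/ppP => g ng; rewrite ffunE (negbTE ng).
have hs g : @homog K (schr K) (sgen_odd g) (sbasis K g) := @sbasis_homog K g.
have hZ g c : @homog K (schr K) (sgen_odd g) (c *: sbasis K g).
  by rewrite -[_ *: _]addr0; apply: homogZD => //; rewrite /homog linear0.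
case=> [a0|b0].
  (* The duals are taken without [f] and [F] coordinates. Those of [x] then determine [c0] and [c1],
     since [y0] and [y1] have [- a ^+ 2] and [a] there. *)
  exists (- a^-1 *: sbasis K gh + (- b / a^+2) *: sbasis K ge), (- a^-1 *: sbasis K ge),
    (- a^-1 *: sbasis K gE); split.
  - by apply: homogZD; [apply: (hs gh)|apply: (hZ ge)].
  - exact: (hZ ge).
  - exact: (hZ gE).
  move=> x; exists (- (x gf : K) / a ^+ 2), ((x gF : K) / a), (tail x); split=> //.
  rewrite phi_br_p phi_br_q phi_br_G.
  apply/ffunP => k; rewrite !ffunE !sgen_eqbE /GRing.scale /=.
  by case: k => /=; field.
(* Symmetrically, the duals avoid [e] and [E], where [y0] and [y1] have the coordinates [b ^+ 2] and
   [b]. *)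
exists (- b^-1 *: sbasis K gf), (b^-1 *: sbasis K gh + (- a / b^+2) *: sbasis K gf),
    (b^-1 *: sbasis K gF); split.
- exact: (hZ gf).
- by apply: homogZD; [apply: (hs gh)|apply: (hZ gf)].
- exact: (hZ gF).
move=> x; exists ((x ge : K) / b ^+ 2), ((x gE : K) / b), (tail x); split=> //.
rewrite phi_br_p phi_br_q phi_br_G.
apply/ffunP => k; rewrite !ffunE !sgen_eqbE /GRing.scale /=.
by case: k => /=; field.
Qed.

Lemma phi_at_neq0 : (exists x, phi x <> 0) -> a != 0 \/ b != 0.
Proof.
move=> [x nx]; case: (eqVneq a 0) => [a0|]; last by left.
right; apply/eqP => b0; apply: nx.
by rewrite phi_extE /phi_ext a0 b0 !mulr0 addr0.
Qed.

End Functional.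

(** * Whittaker vectors and the filtration by word length *)

Section WhittakerVectors.
Variables (K : fieldType) (phi : lieHom (schr_p K) (base_lie K)).
Hypothesis charK : [pchar K] =i pred0.
Variable V : supermodule (schr K).
Local Notation pe := (phi_ext phi).
Local Notation Y := (@act K (schr K) V (y1 phi)).
Implicit Types (u v w : V) (t x y : schr K).

Lemma whittakerP v : whittaker_vector phi v <->
  forall t, t \in pp K -> act t v = pe t *: v.
Proof.
split=> [wv t tp|wv t]; last by rewrite phi_extE wv // subvsP.
have := wv (vsproj (pp K) t); rewrite phi_extE /p_incl /=.
by rewrite vsprojK.
Qed.

(** As [y1] is odd, [[y1, y1] = 2 y0] acts as twice the square of [y1], and characteristic zero
    cancels the 2. *)
Lemma act_y0E v : act (y0 phi) v = Y (Y v).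
Proof.
have := act_br v (y1_homog phi) (y1_homog phi).
rewrite br_y1_y1 actZl /sgn /= expr1 scaleN1r opprK -mulr2n -scaler_nat.
by apply: scalerI; rewrite ((pcharf0P K).1 charK).
Qed.

Lemma homog_iter_y1 i w j : homog i w -> homog (odd j (+) i) (iter j Y w).
Proof.
move=> hw; elim: j => [//|j IH]; rewrite iterS oddS -[~~ _]addTb -addbA.
exact: act_homog (y1_homog phi) IH.
Qed.

(** Even elements of the ideal preserve parity, and odd ones kill [v] because [phi_ext] vanishes on
    them. *)
Lemma whittaker_hc i v : whittaker_vector phi v -> whittaker_vector phi (hc i v).
Proof.
move=> wv t; rewrite phi_extE; set x := p_incl K t.
have xp k : hc k x \in pp K by apply/pp_hc/subvsP.
move/whittakerP: wv => wv.
have E k : act (hc k x) (hc i v) = hc (i (+) k) (act (hc k x) v).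
  by rewrite (hc_act_homog _ _ (homog_hc k x)) addbK.
rewrite act_hcD !E addbF !wv //.
rewrite (phi_ext_odd _ (homog_hc true x)) scale0r !linear0 addr0 linearZ_LR /=.
by congr (_ *: _); rewrite /phi_ext !ffunE.
Qed.

(** The bracket of [t] with [y1] lies in the ideal, so it acts on [v] by a scalar, which is zero by
    [phi_br_y1]. *)
Lemma whittaker_y1 v : whittaker_vector phi v -> whittaker_vector phi (Y v).
Proof.
move=> wv t; rewrite phi_extE; set x := p_incl K t.
have xp k : hc k x \in pp K by apply/pp_hc/subvsP.
move/whittakerP: wv => wv.
have E k : act (hc k x) (Y v) = pe (hc k x) *: Y v.
  rewrite (act_comm v (homog_hc k x) (y1_homog phi)) (wv (hc k x)) // wv ?pp_br //.
  rewrite phi_br_y1 // scale0r add0r actZr scalerA.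
  by rewrite sgn_phi_ext //; apply: homog_hc.
by rewrite act_hcD !E -scalerDl -{3}[x]hcD /phi_ext !ffunE !mulrDl addrACA.
Qed.

Lemma act_sub_comm i j t x v : homog i t -> homog j x ->
  act t (act x v) - pe t *: act x v =
  act (br t x) v + sgn K i j *: act x (act t v - pe t *: v).
Proof.
move=> ht hx; rewrite (act_comm v ht hx) -addrA actBr scalerBr actZr scalerA.
by rewrite sgn_phi_ext.
Qed.

Lemma whittaker_iter_y1 w j : whittaker_vector phi w ->
  whittaker_vector phi (iter j Y w).
Proof. by move=> ww; elim: j => [//|j IH]; apply: whittaker_y1. Qed.

Definition y1_orbit w u : Prop := exists j, u = iter j Y w.

Section Filtration.
Variable w : V.

(** The index exceeds the word length by one, so that lowering the index makes sense on the orbit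
    too: there it means vanishing. Letters are homogeneous so that the sign rule applies to them. *)
Fixpoint fil_mem (k : nat) : V -> Prop :=
  if k is k'.+1 then
    lspan (fun u => y1_orbit w u \/
      exists i x v, [/\ homog i x, fil_mem k' v & u = act x v])
  else fun u => u = 0.

Lemma fil0 k : fil_mem k 0.
Proof. by case: k => [//|k]; apply: lspan0. Qed.
Lemma filP k c u v : fil_mem k u -> fil_mem k v -> fil_mem k (c *: u + v).
Proof.
case: k => [->->|k]; first by rewrite /= scaler0 addr0.
exact: lspan_subproof.
Qed.
Definition fil k : subspace V := Subspace (@fil0 k) (@filP k).

Lemma fil_orbit k u : y1_orbit w u -> fil k.+1 u.
Proof. by move=> ou; apply: lspan_gen; left. Qed.

Lemma fil_act_homog k i x v : homog i x -> fil k v -> fil k.+1 (act x v).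
Proof. by move=> hx fv; apply: lspan_gen; right; exists i, x, v. Qed.

Lemma fil_act k x v : fil k v -> fil k.+1 (act x v).
Proof.
move=> fv; rewrite act_hcD; apply: smemD;
  by apply: (fil_act_homog (homog_hc _ _)).
Qed.

Lemma filS k v : fil k v -> fil k.+1 v.
Proof.
elim: k v => [_ ->|k IH v]; first exact: fil0.
apply: lspan_sub => u [ou|[i [x [u' [hx fu ->]]]]]; first exact: fil_orbit.
by apply: fil_act; apply: IH.
Qed.

Lemma fil_le k l v : (k <= l)%N -> fil k v -> fil l v.
Proof. by move=> /subnK <-; elim: (l - k)%N => [//|n IH] /IH/filS. Qed.

(** Induction on words, with the index of [N] one below that of the filtration; closure under
    combinations passes from words to their span. *)
Lemma fil_ind (N : nat -> V -> Prop) :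
  (forall k, N k 0) ->
  (forall k c u v, N k u -> N k v -> N k (c *: u + v)) ->
  (forall k u, y1_orbit w u -> N k u) ->
  (forall k i x v, homog i x -> fil k.+1 v -> N k v -> N k.+1 (act x v)) ->
  forall k v, fil k.+1 v -> N k v.
Proof.
move=> N0 NP No Na; elim=> [|k IH] v.
  apply: (lspan_sub (N := Subspace (N0 0) (NP 0))) => u [ou|]; first exact: No.
  by move=> [i [x [u' [_ /= -> ->]]]]; rewrite act0r; apply: N0.
apply: (lspan_sub (N := Subspace (N0 k.+1) (NP k.+1))) => u [ou|]; first exact: No.
by move=> [i [x [u' [hx fu ->]]]]; apply: (Na _ i) => //; apply: IH.
Qed.

(** Pushing [y1] to the right through a word only creates brackets, each again a single letter, and
    at the end the orbit of [w] absorbs [y1]. *)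
Lemma fil_y1 k v : fil k v -> fil k (Y v).
Proof.
case: k v => [_ ->|]; first by rewrite /= act0r.
apply: (@fil_ind (fun k v => fil k.+1 (Y v))) => [k|k c u v|k u [j ->]|k i x v hx fv IH].
- by rewrite act0r; apply: smem0.
- by rewrite actDr actZr; apply: smemP.
- by apply: fil_orbit; exists j.+1.
rewrite (act_comm v (y1_homog phi) hx); apply: smemD; first exact: fil_act.
by apply: smemZ; apply: fil_act.
Qed.

Lemma fil_y0 k v : fil k v -> fil k (act (y0 phi) v).
Proof. by move=> fv; rewrite act_y0E; do 2!apply: fil_y1. Qed.

Lemma fil_hc k l i v : homog l w -> fil k v -> fil k (hc i v).
Proof.
move=> hw; case: k v => [_ ->|k v fv]; first by rewrite /= linear0.
move: k v fv i.
apply: (@fil_ind (fun k v => forall i, fil k.+1 (hc i v))) =>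
  [k i|k c u v Hu Hv i|k u [j ->] i|k j x v hx fv IH i].
- by rewrite linear0; apply: smem0.
- by rewrite hc_linear; apply: smemP; [apply: Hu|apply: Hv].
- rewrite -(homog_iter_y1 j hw) hcK; case: eqP => _; last exact: smem0.
  by rewrite (homog_iter_y1 j hw); apply: fil_orbit; exists j.
by rewrite (hc_act_homog _ _ hx); apply: fil_act.
Qed.

Hypothesis ww : whittaker_vector phi w.

(** On the orbit the difference vanishes, its vectors being Whittaker. Past a letter [x], the new
    term [[t, x]] is again in the ideal, so by induction it acts as a scalar up to lower index. *)
Lemma fil_pp k i t v : t \in pp K -> homog i t -> fil k.+1 v ->
  fil k (act t v - pe t *: v).
Proof.
move=> tp ht fv; move: k v fv i t tp ht.
apply: (@fil_ind (fun k v => forall i t, t \in pp K -> homog i t ->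
  fil k (act t v - pe t *: v))) => [k|k c u v Hu Hv|k u [j ->]|k j x v hx fv IH] i t tp ht.
- by rewrite act0r scaler0 subr0; apply: smem0.
- rewrite actDr actZr scalerDr scalerA mulrC -scalerA opprD addrACA -scalerBr.
  by apply: smemP; [apply: (Hu i)|apply: (Hv i)].
- have /whittakerP -> // := @whittaker_iter_y1 w j ww.
  by rewrite subrr; apply: smem0.
rewrite (act_sub_comm v ht hx).
apply: smemD; last by apply/smemZ/fil_act/(IH i).
rewrite -[act _ _](subrK (pe (br t x) *: v)); apply: smemD; last exact: smemZ.
by apply/filS/(IH (i (+) j)); [apply: pp_br|apply: br_homog].
Qed.

Lemma fil_pp_sub k i t v : t \in pp K -> homog i t -> fil k v -> fil k (act t v).
Proof.
case: k => [_ _ ->|k tp ht fv]; first by rewrite /= act0r.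
rewrite -[act _ _](subrK (pe t *: v)); apply: smemD; last exact: smemZ.
by apply/filS/(fil_pp _ ht).
Qed.

Definition eul A t v : V := act A (act t v - pe t *: v).

(** Moving [t] and then [A] past [x] gives the same sign twice, as they share a parity. The term
    with [[A, x]] and the deviation of [[t, x]] from its scalar both land in [fil k.+1]. *)
Lemma eul_act k i j A t x v : homog i A -> homog i t -> t \in pp K -> homog j x ->
  fil k.+1 v ->
  fil k.+1 (eul A t (act x v) - (pe (br t x) *: act A v + act x (eul A t v))).
Proof.
move=> hA ht tp hx fv; rewrite /eul; set u := act t v - _.
have fu : fil k u by apply: (fil_pp _ ht).
rewrite (act_sub_comm v ht hx) -/u.
rewrite actDr actZr (act_comm u hA hx) scalerDr scalerA sgnK scale1r opprD addrACA.
rewrite addrK; apply: smemD; last by apply/smemZ/fil_act.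
rewrite -actZr -actBr; apply: fil_act.
by apply: (@fil_pp k (i (+) j)) => //; [apply: pp_br|apply: br_homog].
Qed.

(** The dual basis expands [x v] into the terms [phi_ext [t, x] A v] and a remainder of lower index.
    These terms are the ones that [eul_act] produces, so each letter adds 1 to the eigenvalue. *)
Lemma fil_euler Ap Aq AG k v : dual_basis phi Ap Aq AG -> fil k.+1 v ->
  fil k (eul Ap (sbasis K gp) v + (eul Aq (sbasis K gq) v + eul AG (sbasis K gG) v)
         - k%:R *: v).
Proof.
case=> hp hq hG dualA.
pose Eu v := eul Ap (sbasis K gp) v + (eul Aq (sbasis K gq) v + eul AG (sbasis K gG) v).
have EuP c u u' : Eu (c *: u + u') = c *: Eu u + Eu u'.
  have E A t : eul A t (c *: u + u') = c *: eul A t u + eul A t u'.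
    rewrite /eul -actZr -actDr; congr act.
    by rewrite actDr actZr scalerDr scalerA mulrC -scalerA opprD addrACA -scalerBr.
  by rewrite /Eu !E !scalerDr [X in _ + X = _]addrACA [LHS]addrACA.
rewrite -/(Eu v).
move: k v; apply: (@fil_ind (fun k v => fil k (Eu v - k%:R *: v))).
- by move=> k; rewrite /Eu /eul !act0r !scaler0 !subr0 !act0r !addr0; apply: smem0.
- move=> k c u v Hu Hv; rewrite EuP [X in _ - X]scalerDr.
  rewrite scalerA mulrC -scalerA opprD addrACA -scalerBr.
  exact: smemP.
- move=> k u [j ->]; have E A t : t \in pp K -> eul A t (iter j Y w) = 0.
    move=> tp; have /whittakerP wj := @whittaker_iter_y1 w j ww.
    by rewrite /eul wj // subrr act0r.
  (* The Euler operator kills the orbit; [k] times an orbit vector is zero for [k = 0] and lies in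
     [fil k] otherwise. *)
  rewrite /Eu !E ?sbasis_pp // !addr0 add0r; apply: smemN.
  case: k => [|k]; first by rewrite scale0r; apply: smem0.
  by apply/smemZ/fil_orbit; exists j.
move=> k i x v hx fv IH; have [c0 [c1 [t [tp dx]]]] := dualA x.
set cp := pe _ in dx; set cq := pe _ in dx; set cG := pe _ in dx.
have Hp := eul_act hp (sbasis_homog K gp) (sbasis_pp (g := gp) K isT) hx fv.
have Hq := eul_act hq (sbasis_homog K gq) (sbasis_pp (g := gq) K isT) hx fv.
have HG := eul_act hG (sbasis_homog K gG) (sbasis_pp (g := gG) K isT) hx fv.
have {dx} dx : act x v = cp *: act Ap v + (cq *: act Aq v + (cG *: act AG v
    + (c0 *: act (y0 phi) v + (c1 *: Y v + act t v)))).
  by have /= E := congr1 (fun y : schr K => act y v) dx; rewrite 5!actDl 5!actZl in E.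
(* [y0], [y1] and the ideal preserve each step of the filtration, so the remainder [r] stays in
   [fil k.+1]. *)
set r := c0 *: _ + _ in dx.
have fr : fil k.+1 r.
  rewrite /r; apply: smemP; first exact: fil_y0.
  apply: smemP; first exact: fil_y1.
  rewrite act_hcD; apply: smemD;
    by apply: (fil_pp_sub _ (homog_hc _ t)) => //; apply: pp_hc.
have fE : fil k.+1 (act x (Eu v - k%:R *: v)) by apply: fil_act.
(* The three errors of [eul_act], the image under [x] of the error for [v], and [- r] add up to the
   error for [x v]. *)
have -> : Eu (act x v) - k.+1%:R *: act x v =
   (eul Ap (sbasis K gp) (act x v) - (cp *: act Ap v + act x (eul Ap (sbasis K gp) v)))
 + ((eul Aq (sbasis K gq) (act x v) - (cq *: act Aq v + act x (eul Aq (sbasis K gq) v)))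
 + ((eul AG (sbasis K gG) (act x v) - (cG *: act AG v + act x (eul AG (sbasis K gG) v)))
 + (act x (Eu v - k%:R *: v) - r))).
  rewrite actBr !actZr -natr1 scalerDl scale1r [X in _ - (_ + X)]dx /Eu !actDr.
  rewrite !opprD !addrA.
  by rewrite [RHS](ACl (1*4*7*13*2*5*8*14*15*16*3*10*6*11*9*12))%AC /= !subrK.
by do 3?apply: smemD => //; apply: smemB.
Qed.
End Filtration.
End WhittakerVectors.

(** * Polynomials in a linear operator *)

Section PolynomialAction.
Variables (K : fieldType) (V : lmodType K) (T : V -> V).
Hypothesis T_lin : linear T.

Definition pact (g : {poly K}) (u : V) : V := \sum_(i < size g) g`_i *: iter i T u.

Lemma pactEw n (g : {poly K}) u : (size g <= n)%N -> pact g u = \sum_(i < n) g`_i *: iter i T u.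
Proof.
move=> le_gn; rewrite /pact (big_ord_widen n (fun i => g`_i *: iter i T u)) //.
rewrite big_mkcond; apply: eq_bigr => i _; case: ltnP => // /(nth_default 0) ->.
by rewrite scale0r.
Qed.

Lemma pactD (g h : {poly K}) u : pact (g + h) u = pact g u + pact h u.
Proof.
pose n := maxn (size g) (size h).
rewrite !(@pactEw n) ?leq_maxl ?leq_maxr //; last exact: size_polyD.
by rewrite -big_split; apply: eq_bigr => i _; rewrite coefD scalerDl.
Qed.

Lemma pactZ c (g : {poly K}) u : pact (c *: g) u = c *: pact g u.
Proof.
rewrite !(@pactEw (size g)) //; last exact: size_scale_leq.
by rewrite scaler_sumr; apply: eq_bigr => i _; rewrite coefZ scalerA.
Qed.

Lemma pactC c u : pact c%:P u = c *: u.
Proof. by rewrite (@pactEw 1) ?size_polyC_leq1 // big_ord1 coefC. Qed.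

Lemma pactMX (g : {poly K}) u : pact (g * 'X) u = T (pact g u).
Proof.
rewrite (@pactEw (size g).+1); last first.
  by apply: leq_trans (size_polyMleq _ _) _; rewrite size_polyX addn2.
rewrite big_ord_recl coefMX scale0r add0r /pact.
rewrite -[T]/(HB.pack_for {linear V -> V} T (GRing.isLinear.Build _ _ _ _ T T_lin) : V -> V).
by rewrite linear_sum; apply: eq_bigr => i _; rewrite linearZ_LR coefMX.
Qed.

Lemma pactT (g : {poly K}) u : pact g (T u) = pact (g * 'X) u.
Proof.
rewrite (@pactEw (size g).+1 (g * 'X)); last first.
  by apply: leq_trans (size_polyMleq _ _) _; rewrite size_polyX addn2.
rewrite big_ord_recl coefMX scale0r add0r; apply: eq_bigr => i _.
by rewrite coefMX /= -iterSr.
Qed.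

Lemma pactXn n u : pact 'X^n u = iter n T u.
Proof.
elim: n => [|n IH]; first by rewrite expr0 pactC scale1r.
by rewrite exprSr pactMX IH.
Qed.

Lemma lspan_iter_pact u v : lspan (fun v => exists j, v = iter j T u) v ->
  exists g, v = pact g u.
Proof.
elim=> [|c _ y [j ->] _ [g ->]]; first by exists 0; rewrite /pact size_poly0 big_ord0.
by exists (c *: 'X^j + g); rewrite pactD pactZ pactXn.
Qed.

Hypothesis closedK : GRing.closed_field_axiom K.

(** A root [c] of [g] leaves a cofactor [h]. Either [h] kills [u] and has smaller degree, or
    [pact h u] is an eigenvector for [c]. *)
Lemma pact_eigen g u : g != 0 -> u <> 0 -> pact g u = 0 ->
  exists c h, pact h u <> 0 /\ T (pact h u) = c *: pact h u.
Proof.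
move: {2}(size g) (leqnn (size g)) => n; elim: n g => [|n IH] g.
  by rewrite size_poly_leq0 => ->.
move=> le_gn g0 u0; have [/size_poly1P [c c0 ->]|g1] := boolP (size g == 1)%N.
  by rewrite pactC => /eqP; rewrite scaler_eq0 (negbTE c0) => /eqP.
have [c /factor_theorem [h dg]] := PreClosedField.closed_rootP closedK g g1.
have h0 : h != 0 by apply: contraNneq g0 => h0; rewrite dg h0 mul0r.
have le_hn : (size h <= n)%N.
  by move: le_gn; rewrite dg size_Mmonic ?monicXsubC // size_XsubC addn2.
have -> : pact g u = T (pact h u) - c *: pact h u.
  by rewrite dg mulrBr pactD pactMX -mulrN -polyCN mulrC mul_polyC pactZ scaleNr.
have [hu _|hu /eqP] := pselect (pact h u = 0); first exact: (IH h).
by rewrite subr_eq0 => /eqP; exists c, h.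
Qed.
End PolynomialAction.

(** * Modules generated by a Whittaker vector *)

Section WhittakerModules.
Variables (K : fieldType) (phi : lieHom (schr_p K) (base_lie K)).
Hypothesis charK : [pchar K] =i pred0.
Hypothesis phi_neq0 : exists x, phi x <> 0.
Variable V : supermodule (schr K).
Local Notation pe := (phi_ext phi).
Local Notation Y := (@act K (schr K) V (y1 phi)).
Implicit Types (u v w : V) (t x y : schr K).

(** The union of the filtration is a subsupermodule that contains [w]. *)
Lemma generated_fil l w v : homog l w -> generated_by w -> exists k, fil phi w k v.
Proof.
move=> hw gw; pose N v := exists k, fil phi w k v.
have N0 : N 0 by exists 0%N; apply: smem0.
have NP c u u' : N u -> N u' -> N (c *: u + u').
  move=> [k fu] [k' fu']; exists (maxn k k'); apply: smemP.
    by apply: fil_le fu; apply: leq_maxl.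
  by apply: fil_le fu'; apply: leq_maxr.
have Nhc i u : Subspace N0 NP u -> Subspace N0 NP (hc i u).
  by move=> [k fu]; exists k; apply: (fil_hc _ hw).
have Nact x u : Subspace N0 NP u -> Subspace N0 NP (act x u).
  by move=> [k fu]; exists k.+1; apply: fil_act.
apply: (gw (Subsupermodule Nhc Nact)); exists 1%N.
by apply: fil_orbit; exists 0%N.
Qed.

Lemma whittaker_orbit l w v : homog l w -> generated_by w ->
  whittaker_vector phi w -> whittaker_vector phi v -> lspan (y1_orbit phi w) v.
Proof.
move=> hw gw ww /whittakerP wv.
have [Ap [Aq [AG dA]]] := dual_basis_exists (phi_at_neq0 phi_neq0).
(* The Euler operator kills [v], so [k.+1] times [v] drops from [fil k.+2] to [fil k.+1], and
   characteristic zero allows the division. *)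
have H1 k : fil phi w k.+1 v -> fil phi w 1 v.
  elim: k => [//|k IH] fv; apply: IH.
  have := fil_euler charK ww dA fv.
  have E A g : in_p g -> eul phi A (sbasis K g) v = 0.
    by move=> pg; rewrite /eul wv ?sbasis_pp // subrr act0r.
  rewrite !E // !addr0 add0r => /smemN; rewrite opprK => /(smemZ (k.+1%:R^-1)).
  by rewrite scalerA mulVf ?scale1r // ((pcharf0P K).1 charK).
have [k fv] := generated_fil v hw gw.
have {H1 fv k} : fil phi w 1 v by apply: (H1 k); apply: filS.
(* In [fil 1] letters act only on zero, which leaves the span of the orbit. *)
apply: (lspan_sub (N := lspan_subspace (y1_orbit phi w))) => u [|[i [x [u' [_ /= -> ->]]]]].
  exact: lspan_gen.
by rewrite act0r; apply: lspan0.
Qed.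

(** As long as [v] is not Whittaker, some nonzero [(t - phi_ext t) v] lies in [N] one step lower;
    this stops because [fil 0] is zero. *)
Lemma sub_whittaker l w (N : subsupermodule V) v : homog l w -> generated_by w ->
  whittaker_vector phi w -> N v -> v <> 0 ->
  exists u, [/\ N u, u <> 0 & whittaker_vector phi u].
Proof.
move=> hw gw ww; have [k fv] := generated_fil v hw gw.
elim: k v fv => [v /= -> _ //|k IH v fv Nv v0].
have [wv|nwv] := pselect (whittaker_vector phi v); first by exists v.
(* [fil_pp] requires a homogeneous [t]. If no such [t] fails, adding the two components shows that
   no [t] fails. *)
have [[i [t [tp ht nt]]]|H] := pselect (exists i t,
    [/\ t \in pp K, homog i t & act t v - pe t *: v <> 0]).
  apply: (IH (act t v - pe t *: v)) => //; first exact: (fil_pp ww tp ht).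
  by apply: smemB; [apply: sub_act|apply: smemZ].
case: nwv; apply/whittakerP => t tp.
have E i : act (hc i t) v = pe (hc i t) *: v.
  apply: contrapT => nt; apply: H; exists i, (hc i t); split.
  - exact: pp_hc.
  - exact: homog_hc.
  by move/eqP; rewrite subr_eq0 => /eqP.
rewrite act_hcD !E -scalerDl -[in RHS](hcD t) -[in RHS](scale1r (hc false t)).
by rewrite phi_ext_linear mul1r.
Qed.

(** [y0] acts as the square of [y1], so it commutes with [y1] and keeps its eigenvalue along the
    orbit. *)
Lemma y0_orbit w xi v : act (y0 phi) w = xi *: w -> lspan (y1_orbit phi w) v ->
  act (y0 phi) v = xi *: v.
Proof.
move=> yw; have YC : forall u, act (y0 phi) (Y u) = Y (act (y0 phi) u).
  by move=> u; rewrite !act_y0E.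
elim=> [|c _ y [j ->] _ IH]; first by rewrite act0r scaler0.
rewrite actDr actZr IH scalerDr scalerA mulrC -scalerA; congr (_ *: _ + _).
by elim: j => [//|j IHj]; rewrite iterS YC IHj actZr.
Qed.

Lemma y0_whittaker l w xi v : homog l w -> generated_by w -> whittaker_vector phi w ->
  act (y0 phi) w = xi *: w -> whittaker_vector phi v -> act (y0 phi) v = xi *: v.
Proof. by move=> hw gw ww yw wv; apply: (y0_orbit yw); apply: (whittaker_orbit hw). Qed.

Lemma irreducible_generated v : irreducible V -> v <> 0 -> generated_by v.
Proof. by move=> [_ irr] v0 N Nv; case: (irr N) => // /(_ v Nv). Qed.

(** The square of [y1] is the scalar [xi] on the orbit, so Whittaker vectors have the form
    [c w + d y1 w]. The two terms have opposite parities, hence both lie in [N] as soon as the sum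
    does. *)
Lemma eigen_sub l w xi (N : subsupermodule V) :
  homog l w -> generated_by w -> whittaker_vector phi w ->
  act (y0 phi) w = xi *: w -> (xi = 0 -> Y w = 0) ->
  (exists2 v, N v & v <> 0) -> forall v, N v.
Proof.
move=> hw gw ww yw yw0 [v Nv v0]; apply: (gw N).
have [u [Nu u0 wu]] := sub_whittaker hw gw ww Nv v0.
have [c [d du]] : exists c d, u = c *: w + d *: Y w.
  have := whittaker_orbit hw gw ww wu.
  elim=> [|e _ y [j ->] _ [c [d ->]]]; first by exists 0, 0; rewrite !scale0r addr0.
  suff [c' [d' ->]] : exists c' d', iter j Y w = c' *: w + d' *: Y w.
    by exists (e * c' + c), (e * d' + d); rewrite scalerDr !scalerDl !scalerA addrACA.
  elim: j => [|j [c' [d' IH]]]; first by exists 1, 0; rewrite scale1r scale0r addr0.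
  by exists (d' * xi), c'; rewrite iterS IH actDr !actZr -act_y0E // yw scalerA addrC.
have E1 : hc l u = c *: w.
  rewrite du hc_linear hw linearZ_LR /=.
  by rewrite (hc_act_homog _ _ (y1_homog phi)) addbT homog_hcN // act0r scaler0 addr0.
have E2 : hc (~~ l) u = d *: Y w.
  rewrite du hc_linear homog_hcN // scaler0 add0r linearZ_LR /=.
  by rewrite (hc_act_homog _ _ (y1_homog phi)) addbT negbK hw.
have [c0|c0] := eqVneq c 0; last first.
  have : N (c^-1 *: hc l u) by apply/smemZ/sub_hc.
  by rewrite E1 scalerA mulVf // scale1r.
(* Now [u = d y1 w] is nonzero, which excludes [xi = 0]; applying [y1] once more recovers a nonzero
   multiple of [w]. *)
have d0 : d != 0 by apply: contra_notN u0 => /eqP d0; rewrite du c0 d0 !scale0r addr0.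
have xi0 : xi != 0.
  by apply: contra_notN u0 => /eqP/yw0 Y0; rewrite du c0 Y0 scale0r scaler0 addr0.
have : N (xi^-1 *: Y (d^-1 *: hc (~~ l) u)) by apply/smemZ/sub_act/smemZ/sub_hc.
by rewrite E2 scalerA mulVf // scale1r -act_y0E // yw scalerA mulVf // scale1r.
Qed.

Hypothesis closedK : GRing.closed_field_axiom K.

Lemma irreducible_eigen l w : irreducible V -> homog l w -> whittaker_vector phi w ->
  w <> 0 -> exists xi, act (y0 phi) w = xi *: w /\ (xi = 0 -> Y w = 0).
Proof.
move=> irr hw ww w0.
have [xi yw] : exists xi, act (y0 phi) w = xi *: w.
  have [y0w|y0w] := pselect (act (y0 phi) w = 0); first by exists 0; rewrite scale0r.
  have wy : whittaker_vector phi (iter 2 Y w) by apply: whittaker_iter_y1.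
  have hy : homog l (iter 2 Y w) by apply: (homog_iter_y1 phi 2 hw).
  have ny : iter 2 Y w <> 0 by rewrite /= -act_y0E.
  have Yl : linear Y by apply: act_linearr.
  (* [iter 2 Y w] is [y0 w]; it generates [V], so [w] is a polynomial in [y1] applied to it. *)
  have [g dw] := lspan_iter_pact Yl
    (whittaker_orbit hy (irreducible_generated irr ny) wy ww).
  have [c [h [hw0 Yh]]] : exists c h, pact Y h w <> 0 /\ Y (pact Y h w) = c *: pact Y h w.
    (* [1 - g * 'X^2] kills [w], and it is nonzero because its value at 0 is 1. *)
    apply: (@pact_eigen _ _ _ Yl closedK (1 - g * 'X^2)) => //.
      apply/eqP => /(congr1 (fun f : {poly K} => f.[0])).
      by rewrite !hornerE /= mulr0 subr0 => /eqP; rewrite oner_eq0.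
    rewrite -scaleN1r pactD pactZ pactC scale1r scaleN1r.
    by rewrite exprSr mulrA -!pactT -[pact Y g _]dw subrr.
  have whh : whittaker_vector phi (pact Y h w).
    rewrite /pact; elim/big_rec: _ => [|j u _ wu] t; first by rewrite act0r scaler0.
    rewrite actDr actZr wu whittaker_iter_y1 // scalerDr; congr (_ + _).
    by rewrite !scalerA mulrC.
  have y0h : act (y0 phi) (pact Y h w) = (c * c) *: pact Y h w.
    by rewrite act_y0E // !(Yh, actZr) scalerA.
  (* The eigenvector of the odd [y1] may be inhomogeneous, but [y0] is even, so each component keeps
     the eigenvalue [c * c]. *)
  have [i hi] : exists i, hc i (pact Y h w) <> 0.
    apply: contrapT => H; apply: hw0; rewrite -[LHS]hcD.
    suff E i : hc i (pact Y h w) = 0 by rewrite !E addr0.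
    by apply: contrapT => Hi; apply: H; exists i.
  exists (c * c); apply: (@y0_whittaker i (hc i (pact Y h w))) => //.
  - exact: homog_hc.
  - exact: irreducible_generated.
  - exact: whittaker_hc.
  have := hc_act_homog i (pact Y h w) (y0_homog phi).
  by rewrite addbF => <-; rewrite y0h linearZ_LR.
(* If [y1 w] were nonzero, its orbit would be itself followed by zeros, making [w] a multiple of a
   vector of the other parity. *)
exists xi; split=> // xi0; apply: contrapT => Yw.
have hY := act_homog (y1_homog phi) hw.
have wY := whittaker_y1 ww.
have YY : Y (Y w) = 0 by rewrite -act_y0E // yw xi0 scale0r.
have [c dw] : exists c, w = c *: Y w.
  suff H v : lspan (y1_orbit phi (Y w)) v -> exists c, v = c *: Y w.
    exact/H/(whittaker_orbit hY (irreducible_generated irr Yw) wY ww).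
  elim=> [|e _ y [j ->] _ [c ->]]; first by exists 0; rewrite scale0r.
  case: j => [|j]; first by exists (e + c); rewrite scalerDl.
  exists c; rewrite iterSr YY; suff -> : iter j Y 0 = 0 by rewrite scaler0 add0r.
  by elim: j => [//|j IH]; rewrite iterS IH act0r.
apply: w0; apply: (homog_diff hw).
by rewrite dw /homog linearZ_LR /= hY.
Qed.

End WhittakerModules.

(** * The action of the enveloping algebra on a supermodule *)

Section EnvelopingAction.
Variables (K : fieldType) (L : lieSuperalgebra K) (V : supermodule L).
Local Notation F := (freealg K (env_sym L)).

(** Letting [(i, x)] act through [hc i x] makes the linearity and projection relations of [env_rel]
    hold for arbitrary [x]. *)
Definition word_act (s : seq (env_sym L)) (v : V) : V :=
  foldr (fun (g : env_sym L) v => act (hc g.1 g.2) v) v s.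

Definition free_act (f : F) (v : V) : V := free_ext (word_act^~ v) f.

Lemma free_act_linearl v : linear (free_act^~ v).
Proof. exact: free_ext_linear. Qed.

Lemma free_act_word s v : free_act (free_word K s) v = word_act s v.
Proof. exact: free_extE. Qed.

Lemma word_act_linear s : linear (word_act s).
Proof. by elim: s => [//|g s IH] c u v /=; rewrite IH act_linearr. Qed.

Lemma free_act_linearr f : linear (free_act f).
Proof.
move=> c u v; move: f; apply: free_lin_eq => [d f g|d f g|s].
- exact: free_act_linearl.
- by rewrite !(free_act_linearl _ d f g) scalerDr scalerA mulrC -scalerA addrACA -!scalerDr.
by rewrite !free_act_word word_act_linear.
Qed.

Lemma free_actM (f g : F) v : free_act (f * g) v = free_act f (free_act g v).
Proof.
move: f; apply: free_lin_eq => [d f f'|d f f'|s].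
- by rewrite mulrDl -scalerAl free_act_linearl.
- exact: free_act_linearl.
move: g; apply: free_lin_eq => [d g g'|d g g'|t].
- by rewrite mulrDr -scalerAr free_act_linearl.
- by rewrite free_act_linearl free_act_linearr.
by rewrite free_wordM !free_act_word /word_act foldr_cat.
Qed.

Lemma free_act_gen i x v : free_act (env_gen i x) v = act (hc i x) v.
Proof. exact: free_act_word. Qed.

Lemma free_act_rel r v : env_rel r -> free_act r v = 0.
Proof.
have fB := linear_sub (free_act_linearl v); have fZ := linear_scale (free_act_linearl v).
case=> [i c x y|i x|i j x y hx hy].
- by rewrite fB free_act_linearl !free_act_gen hc_linear act_linearl subrr.
- by rewrite fB !free_act_gen hcK eqxx subrr.
rewrite !fB fZ !free_actM !free_act_gen hx hy (br_homog hx hy).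
by rewrite (act_br v hx hy) subrr.
Qed.

Lemma free_act_ideal f v : env_ideal L f -> free_act f v = 0.
Proof.
apply: (lspan_ker (free_act_linearl v)) => _ [a [r [b [hr ->]]]].
by rewrite !free_actM (free_act_rel _ hr) (linear_zero (free_act_linearr a)).
Qed.

Definition env_act (u : env L) (v : V) : V := lquot_lift (free_act^~ v) u.

Lemma env_act_pi f v : env_act (env_pi f) v = free_act f v.
Proof.
apply: lquot_liftE; first exact: free_act_linearl.
by move=> g; apply: free_act_ideal.
Qed.

Lemma env_act_linearl v : linear (env_act^~ v).
Proof.
apply: lquot_lift_linear; first exact: free_act_linearl.
by move=> g; apply: free_act_ideal.
Qed.

Lemma env_act_linearr u : linear (env_act u).
Proof.
by have [f <-] := env_pi_surj u => c v v'; rewrite !env_act_pi free_act_linearr.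
Qed.

Lemma env_actM u u' v : env_act (u * u') v = env_act u (env_act u' v).
Proof.
have [f <-] := env_pi_surj u; have [f' <-] := env_pi_surj u'.
by rewrite -env_piM !env_act_pi free_actM.
Qed.

Lemma env_act1 v : env_act 1 v = v.
Proof. by rewrite -env_pi1 env_act_pi; apply: free_act_word [::] v. Qed.

Lemma env_act_in x v : env_act (env_in x) v = act x v.
Proof.
rewrite /env_in env_act_pi (linear_add (free_act_linearl v)) !free_act_gen.
by rewrite -act_hcD.
Qed.

Lemma env_gen_in i (x : L) : env_pi (env_gen i x) = env_in (hc i x).
Proof. by rewrite (env_in_homog (homog_hc i x)) env_gen_hc eqxx. Qed.

Lemma env_ind (W : lmodType K) (N : subspace W) (h : env L -> W) : linear h ->
  N (h 1) -> (forall x u, N (h u) -> N (h (env_in x * u))) -> forall u, N (h u).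
Proof.
move=> hl h1 hx u; have [f <-] := env_pi_surj u.
(* Membership in [N] becomes an equation of linear maps into the quotient, which can be tested on
   words. *)
suff : lpi N (h (env_pi f)) = 0.
  by rewrite -(lpi0 N) => /lpi_eq; rewrite subr0.
move: f; apply: (free_lin_eq (g := fun=> 0)) => [c f g|c f g|s].
- by rewrite env_pi_linear hl lpi_linear.
- by rewrite scaler0 addr0.
rewrite -(lpi0 N); apply/lpi_eq; rewrite subr0.
elim: s => [//|[i x] s IH].
rewrite -cat1s -free_wordM env_piM env_gen_in.
exact: hx.
Qed.

Lemma env_act_hc l i u v : homog l v -> hc i (env_act u v) = env_act (env_hc (i (+) l) u) v.
Proof.
move=> hv; have [f <-] := env_pi_surj u; rewrite env_hcE !env_act_pi.
(* Linearity reduces the claim to words; there [i] must vary, since each letter of parity [j] shifts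
   it by [j]. *)
move: f i; suff H s i : hc i (word_act s v) =
    free_act (word_hc (@gen_parity K L) (i (+) l) (free_word K s)) v.
  move=> f i; move: f; apply: free_lin_eq => [c f g|c f g|s].
  - by rewrite free_act_linearl hc_linear.
  - by rewrite word_hc_linear free_act_linearl.
  by rewrite free_act_word H.
rewrite word_hcE.
elim: s i => [|[j x] s IH] i.
  rewrite -hv hcK hv /=; case: i; case: l {hv}; rewrite /= ?free_act_word //;
  by rewrite (linear_zero (free_act_linearl v)).
rewrite /= (hc_act_homog _ _ (homog_hc j x)) IH.
have -> : (gen_parity (j, x) (+) word_parity (@gen_parity K L) s == i (+) l) =
          (word_parity (@gen_parity K L) s == i (+) j (+) l).
  by rewrite /gen_parity /=; case: j; case: i; case: l {hv IH}; case: word_parity.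
case: eqP => _; first by rewrite !free_act_word.
by rewrite !(linear_zero (free_act_linearl v)) act0r.
Qed.
End EnvelopingAction.

(** * The modules [W] and [L_xi], and maps out of them *)

Section UniversalModule.
Variables (K : fieldType) (phi : lieHom (schr_p K) (base_lie K)).

Lemma tens_w_phi (u : env (schr K)) (n : Cw phi) :
  tens (p_incl K) u n = (n : K) *: ind_uact u (w_phi phi).
Proof.
rewrite /w_phi ind_uactE mulr1.
have -> : n = (n : K) *: (1 : K^o) :> K^o by rewrite [RHS]mulr1.
by rewrite (linear_scale (@tens_linearr _ _ _ (p_incl K) (Cw phi) u)) [_ *: 1]mulr1.
Qed.

Lemma hc_tens i (u : env (schr K)) (n : Cw phi) :
  ind_hc i (tens (p_incl K) u n) = tens (p_incl K) (env_hc i u) n.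
Proof.
have t0 u' : tens (p_incl K) u' (0 : Cw phi) = 0.
  exact: linear_zero (@tens_linearr _ _ _ (p_incl K) (Cw phi) u').
by rewrite ind_hcE; case: i; rewrite [hc true n]/= t0 ?add0r ?addr0.
Qed.

Lemma sub_ind_uact (N : subsupermodule (W phi)) (u : env (schr K)) v :
  N v -> N (ind_uact u v).
Proof.
move=> Nv; apply: (@env_ind _ _ _ N (fun u => ind_uact u v)).
- exact: ind_uact_linearl.
- by rewrite ind_uact1.
move=> x u' Nu; rewrite ind_uactM.
exact: (@sub_act _ _ _ N x _ Nu).
Qed.

Lemma W_generated : generated_by (w_phi phi : W phi).
Proof.
(* As in [env_ind], membership is tested in the quotient, here on pure tensors. *)
move=> N Nw v; suff : lpi N v = 0.
  by rewrite -(lpi0 N) => /lpi_eq; rewrite subr0.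
move: v; apply: (ind_lin_eq (g := fun=> 0)).
- exact: lpi_linear.
- by move=> c f g; rewrite scaler0 addr0.
move=> u n; rewrite tens_w_phi -(lpi0 N); apply/lpi_eq; rewrite subr0.
by apply/smemZ/sub_ind_uact.
Qed.

Definition w_bar xi : L_xi phi xi := lpi _ (w_phi phi).

Lemma w_bar_homog xi : homog false (w_bar xi).
Proof.
rewrite /homog /w_bar [LHS]quot_hcE; congr (lpi _ _).
exact: w_phi_even.
Qed.

Lemma quot_generated (L : lieSuperalgebra K) (M : supermodule L) (N : subsupermodule M) v :
  generated_by v -> generated_by (lpi N v : quot_supermodule N).
Proof.
move=> gv N' N'v u; have [u' <-] := lpi_surj u.
have Phc i x : preim_subspace (@lpi_linear _ _ N) N' x ->
    preim_subspace (@lpi_linear _ _ N) N' (hc i x).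
  by move=> /= /(@sub_hc _ _ _ N' i); rewrite [hc _ _]quot_hcE.
have Pact y x : preim_subspace (@lpi_linear _ _ N) N' x ->
    preim_subspace (@lpi_linear _ _ N) N' (act y x).
  by move=> /= /(@sub_act _ _ _ N' y); rewrite [act _ _]quot_actE.
exact: (gv (Subsupermodule Phc Pact) N'v u').
Qed.

Lemma w_bar_generated xi : generated_by (w_bar xi).
Proof. by apply: quot_generated; apply: W_generated. Qed.

Lemma w_phi_whittaker : whittaker_vector phi (w_phi phi : W phi).
Proof.
move=> x; rewrite [act _ _]ind_uactE mulr1 -[env_in _]mul1r tens_bal.
by rewrite tens_w_phi ind_uact1 [act x _]mulr1.
Qed.

Lemma w_bar_whittaker xi : whittaker_vector phi (w_bar xi).
Proof.
by move=> x; rewrite [act _ _]quot_actE [act _ _]w_phi_whittaker /w_bar lpiZ.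
Qed.

Lemma y0_wE xi : y0_w phi xi = ind_act (y0 phi) (w_phi phi) - xi *: w_phi phi.
Proof.
rewrite /y0_w (linear_sub (ind_uact_linearl (w_phi phi))).
by rewrite (linear_scale (ind_uact_linearl (w_phi phi))) ind_uact1.
Qed.

Lemma usub_meml (c : K) (v v' : W phi) : usub_mem c v v' v.
Proof. by exists 1, 0; rewrite ind_uact1 ind_uact0 scaler0 addr0. Qed.

Lemma usub_memr (v v' : W phi) : usub_mem 1 v v' v'.
Proof. by exists 0, 1; rewrite ind_uact1 ind_uact0 scale1r add0r. Qed.

Lemma w_bar_y0 xi : act (y0 phi) (w_bar xi) = xi *: w_bar xi.
Proof.
rewrite [act _ _]quot_actE /w_bar -lpiZ; apply/lpi_eq.
rewrite [X in sub_space _ X](_ : _ = y0_w phi xi); last exact/esym/y0_wE.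
exact: usub_meml.
Qed.

Lemma w_bar_y1 xi : xi = 0 -> act (y1 phi) (w_bar xi) = 0.
Proof.
move=> xi0; rewrite [act _ _]quot_actE.
rewrite -(lpi0 (usub (0 == xi)%:R (y0_w_even phi xi) (y1_w_odd phi))).
apply/lpi_eq; rewrite subr0 xi0 eqxx.
exact: usub_memr.
Qed.

Section Map.
Variables (V : supermodule (schr K)) (l : bool) (w : V) (xi : K).
Hypotheses (hw : homog l w) (ww : whittaker_vector phi w).
Hypotheses (yw : act (y0 phi) w = xi *: w) (yw0 : xi = 0 -> act (y1 phi) w = 0).

Let tmap (u : env (schr K)) (n : Cw phi) : V := (n : K) *: env_act u w.
(** The map that Frobenius reciprocity attaches to the Whittaker vector [w]. *)
Definition W_map : W phi -> V := ind_lift tmap.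

Let tmap_l n : linear (tmap^~ n).
Proof.
by move=> c u u'; rewrite /tmap env_act_linearl scalerDr scalerA mulrC -scalerA.
Qed.
Let tmap_r u : linear (tmap u).
Proof. by move=> c n n'; rewrite /tmap scalerDl -scalerA. Qed.
Let tmap_b u x n : tmap (u * env_in (p_incl K x)) n = tmap u (act x n).
Proof.
rewrite /tmap env_actM env_act_in ww (linear_scale (env_act_linearr u)) scalerA.
by congr (_ *: _); rewrite mulrC.
Qed.

Lemma W_map_tens u n : W_map (tens (p_incl K) u n) = (n : K) *: env_act u w.
Proof. exact: ind_liftE. Qed.
Lemma W_map_linear : linear W_map.
Proof. exact: ind_lift_linear. Qed.

Lemma W_map_uact u v : W_map (ind_uact u v) = env_act u (W_map v).
Proof.
move: v; apply: ind_lin_eq => [c v v'|c v v'|u' n].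
- by rewrite ind_uact_linearr W_map_linear.
- by rewrite W_map_linear env_act_linearr.
rewrite ind_uactE !W_map_tens env_actM.
by rewrite (linear_scale (env_act_linearr u)).
Qed.

Lemma W_map_w : W_map (w_phi phi) = w.
Proof. by rewrite W_map_tens env_act1 scale1r. Qed.

(** [w_phi] is even and [w] has parity [l], so the map has parity [l]. *)
Lemma W_map_hc i v : hc i (W_map v) = W_map (hc (i (+) l) v).
Proof.
move: v; apply: ind_lin_eq => [c v v'|c v v'|u n].
- by rewrite W_map_linear hc_linear.
- by rewrite hc_linear W_map_linear.
rewrite [X in _ = W_map X](hc_tens (i (+) l) u n).
rewrite (W_map_tens u n) (W_map_tens (env_hc (i (+) l) u) n).
by rewrite (linear_scale (@hc_linear _ V i)) (env_act_hc _ _ hw).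
Qed.

Local Notation N := (usub (0 == xi)%:R (y0_w_even phi xi) (y1_w_odd phi)).

Lemma W_map_act x v : W_map (ind_act x v) = act x (W_map v).
Proof. by rewrite [LHS]W_map_uact env_act_in. Qed.

Lemma W_map_ker v : N v -> W_map v = 0.
Proof.
have E0 : W_map (y0_w phi xi) = 0.
  rewrite y0_wE (linear_sub W_map_linear) (linear_scale W_map_linear).
  by rewrite W_map_act W_map_w yw subrr.
have E1 : W_map (y1_w phi) = act (y1 phi) w by rewrite [LHS]W_map_act W_map_w.
move=> Nv; have {Nv} : usub_mem (0 == xi)%:R (y0_w phi xi) (y1_w phi) v by [].
move: (y0_w phi xi) (y1_w phi) E0 E1 => s s' E0 E1 [u [u' ->]].
have := etrans (W_map_uact u s) (congr1 (env_act u) E0).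
have := etrans (W_map_uact u' s') (congr1 (env_act u') E1).
rewrite (linear_zero (env_act_linearr u)).
move: (ind_uact u s) (ind_uact u' s') => r r' Er' Er.
rewrite (linear_add W_map_linear) (linear_scale W_map_linear) Er Er' add0r.
(* The Kronecker factor keeps the [y1] term only for [xi = 0], when [y1 w] vanishes. *)
case: eqP => [/esym/yw0->|_]; last by rewrite scale0r.
by rewrite (linear_zero (env_act_linearr u')) scaler0.
Qed.

Definition L_map : L_xi phi xi -> V := lquot_lift W_map.

Lemma L_map_pi v : L_map (lpi N v) = W_map v.
Proof. exact: lquot_liftE W_map_linear W_map_ker v. Qed.
Lemma L_map_linear : linear L_map.
Proof. exact: lquot_lift_linear W_map_linear W_map_ker. Qed.
Lemma L_map_act x v : L_map (act x v) = act x (L_map v).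
Proof.
have [v' <-] := lpi_surj v; rewrite [act _ _]quot_actE !L_map_pi.
exact: W_map_act.
Qed.
Lemma L_map_hc i v : hc i (L_map v) = L_map (hc (i (+) l) v).
Proof.
by have [v' <-] := lpi_surj v; rewrite [in RHS]/hc /= quot_hcE !L_map_pi W_map_hc.
Qed.
Lemma L_map_w : L_map (w_bar xi) = w.
Proof. by rewrite L_map_pi W_map_w. Qed.

End Map.
End UniversalModule.

(** * Existence and uniqueness of the scalar *)

Section Classification.
Variables (K : fieldType) (phi : lieHom (schr_p K) (base_lie K)).
Hypothesis charK : [pchar K] =i pred0.
Hypothesis phi_neq0 : exists x, phi x <> 0.

Lemma L_xi_iso (V : supermodule (schr K)) l (w : V) xi :
  irreducible V -> homog l w -> w <> 0 -> whittaker_vector phi w ->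
  act (y0 phi) w = xi *: w -> (xi = 0 -> act (y1 phi) w = 0) ->
  isomorphic_up_to_parity V (L_xi phi xi).
Proof.
move=> irr hw w0 ww yw yw0; pose f := @L_map _ phi V w xi.
have fl : linear f := L_map_linear ww yw yw0.
have fact x v : f (act x v) = act x (f v) := L_map_act ww yw yw0 x v.
have fhc i v : hc i (f v) = f (hc (i (+) l) v) := L_map_hc hw ww yw yw0 i v.
have fw : f (w_bar phi xi) = w := L_map_w ww yw yw0.
have f_inj : injective f.
  have ker0 v : f v = 0 -> v = 0.
    have K0 : f 0 = 0 := linear_zero fl.
    have KP c u u' : f u = 0 -> f u' = 0 -> f (c *: u + u') = 0.
      by move=> fu fu'; rewrite fl fu fu' scaler0 addr0.
    have Khc i u : Subspace K0 KP u -> Subspace K0 KP (hc i u).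
      by move=> /= fu; rewrite -(addbK l i) -fhc fu linear0.
    have Kact x u : Subspace K0 KP u -> Subspace K0 KP (act x u).
      by move=> /= fu; rewrite fact fu act0r.
    (* By [eigen_sub] a nonzero kernel would contain [w_bar], whose image [w] is nonzero. *)
    move=> fv; apply: contrapT => v0; apply: w0; rewrite -fw.
    apply: (@eigen_sub _ _ charK phi_neq0 _ false (w_bar phi xi) xi
      (Subsupermodule Khc Kact)).
    - exact: w_bar_homog.
    - exact: w_bar_generated.
    - exact: w_bar_whittaker.
    - exact: w_bar_y0.
    - exact: w_bar_y1.
    by exists v.
  move=> u u' /eqP; rewrite -subr_eq0 -(linear_sub fl) => /eqP/ker0/eqP.
  by rewrite subr_eq0 => /eqP.
(* The image is a subsupermodule containing the nonzero [w], and [V] is irreducible. *)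
have f_surj v : exists u, f u = v.
  have I0 : exists u, f u = 0 by exists 0; apply: linear_zero.
  have IP c v1 v2 : (exists u, f u = v1) -> (exists u, f u = v2) ->
      exists u, f u = c *: v1 + v2.
    by move=> [u1 <-] [u2 <-]; exists (c *: u1 + u2); rewrite fl.
  have Ihc i v1 : Subspace I0 IP v1 -> Subspace I0 IP (hc i v1).
    by move=> [u <-]; exists (hc (i (+) l) u); rewrite fhc.
  have Iact x v1 : Subspace I0 IP v1 -> Subspace I0 IP (act x v1).
    by move=> [u <-]; exists (act x u); rewrite fact.
  apply: (irreducible_generated irr w0 (N := Subsupermodule Ihc Iact)).
  by exists (w_bar phi xi).
pose g v : L_xi phi xi := projT1 (cid (f_surj v)).
have fK v : f (g v) = v by rewrite /g; case: cid.
have gK v : g (f v) = v by apply: f_inj; rewrite fK.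
have gl : linear g by move=> c u v; apply: f_inj; rewrite fl !fK.
have gact x v : g (act x v) = act x (g v).
  by apply: f_inj; rewrite fact !fK.
have ghc i v : hc i (g v) = g (hc (i (+) l) v).
  by apply: f_inj; rewrite fK -{1}(addbK l i) -fhc fK.
have g_bij : bijective g by exists f.
(* [g] shifts parity by [l], so an odd [w] leads to the parity shift of [L_xi]. *)
case: l hw fhc ghc => hw fhc ghc; [right|left]; constructor.
  apply: (@SmIso _ _ V (parity_shift (L_xi phi xi)) g gl g_bij) => // i v hv.
  by rewrite /homog /= /shift_hc ghc addbT negbK hv.
apply: (@SmIso _ _ V (L_xi phi xi) g gl g_bij) => // i v hv.
by rewrite /homog ghc addbF hv.
Qed.

(** For uniqueness: pulling [w_bar] back along the isomorphism makes [xi] visible inside [V]. *)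
Lemma iso_y0_eigen (V : supermodule (schr K)) xi :
  isomorphic_up_to_parity V (L_xi phi xi) ->
  exists l (w : V), [/\ homog l w, whittaker_vector phi w, generated_by w
                      & act (y0 phi) w = xi *: w].
Proof.
have H l (g : V -> L_xi phi xi) : linear g -> bijective g ->
    (forall i v, hc (i (+) l) (g v) = g (hc i v)) ->
    (forall x v, g (act x v) = act x (g v)) ->
    exists l (w : V), [/\ homog l w, whittaker_vector phi w, generated_by w
                        & act (y0 phi) w = xi *: w].
  move=> gl [f gK fK] ghc gact; have g_inj := can_inj gK.
  exists l, (f (w_bar phi xi)); split.
  - by apply: g_inj; rewrite -ghc addbb fK; apply: w_bar_homog.
  - move=> x; apply: g_inj; rewrite gact (linear_scale gl) fK.
    exact: w_bar_whittaker.
  - move=> N Nw v; rewrite -(gK v).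
    have fl : linear f by move=> c u u'; apply: g_inj; rewrite gl !fK.
    have Phc i u : preim_subspace fl N u -> preim_subspace fl N (hc i u).
      rewrite /= => Nu; have -> : f (hc i u) = hc (i (+) l) (f u).
        by apply: g_inj; rewrite -ghc addbK !fK.
      exact: sub_hc.
    have Pact x u : preim_subspace fl N u -> preim_subspace fl N (act x u).
      rewrite /= => Nu; have -> : f (act x u) = act x (f u).
        by apply: g_inj; rewrite gact !fK.
      exact: sub_act.
    exact: (w_bar_generated (N := Subsupermodule Phc Pact)).
  by apply: g_inj; rewrite gact (linear_scale gl) fK; apply: w_bar_y0.
have homogE (M M' : superspace K) (g : M -> M') : linear g ->
    (forall i v, homog i v -> homog i (g v)) -> forall i v, hc i (g v) = g (hc i v).
  move=> gl gh i v; rewrite -{1}(hcD v) (linear_add gl) (linear_add (@hc_linear _ M' i)).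
  have E k : hc i (g (hc k v)) = if i == k then g (hc k v) else 0.
    by rewrite -(gh _ _ (homog_hc k v)) hcK; case: eqP.
  by rewrite !E; case: i {E}; rewrite ?add0r ?addr0.
case=> -[g].
  apply: (H false g); [exact: iso_linear|exact: iso_bij| |exact: iso_act].
  by move=> i v; rewrite addbF; apply: homogE; [apply: iso_linear|apply: iso_homog].
apply: (H true g); [exact: (iso_linear g)|exact: (iso_bij g)| |exact: (iso_act g)].
move=> i v; rewrite addbT.
exact: (homogE _ (parity_shift (L_xi phi xi)) g (iso_linear g) (@iso_homog _ _ _ _ g)).
Qed.

Hypothesis closedK : GRing.closed_field_axiom K.

Lemma classification (V : supermodule (schr K)) :
  irreducible V -> quasi_whittaker phi V ->
  exists! xi : K, isomorphic_up_to_parity V (L_xi phi xi).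
Proof.
move=> irr [l [w [hw ww gw]]].
have w0 : w <> 0.
  move=> w0; case: irr => -[v v0] _; apply: v0.
  have Z0 : (0 : V) = 0 by [].
  have ZP c (u u' : V) : u = 0 -> u' = 0 -> c *: u + u' = 0.
    by move=> -> ->; rewrite scaler0 addr0.
  have Zhc i u : Subspace Z0 ZP u -> Subspace Z0 ZP (hc i u).
    by move=> /= ->; rewrite linear0.
  have Zact x u : Subspace Z0 ZP u -> Subspace Z0 ZP (act x u).
    by move=> /= ->; rewrite act0r.
  exact: (gw (Subsupermodule Zhc Zact) w0 v).
have [xi [yw yw0]] := irreducible_eigen charK phi_neq0 closedK irr hw ww w0.
exists xi; split; first exact: (L_xi_iso irr hw).
move=> xi' /iso_y0_eigen [l' [w' [hw' ww' gw' yw']]].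
(* On every Whittaker vector [y0] has the scalar that it has on the generator [w']; comparing at [w]
   identifies [xi] and [xi']. *)
have := y0_whittaker charK phi_neq0 hw' gw' ww' yw' ww.
rewrite yw => /eqP; rewrite -subr_eq0 -scalerBl scaler_eq0 subr_eq0.
by case/orP => /eqP.
Qed.
End Classification.

Theorem theorem4p2 (R : realType)
    (phi : lieHom (schr_p R[i]) (base_lie R[i]))
    (phi_neq0 : exists x : schr_p R[i], phi x <> 0)
    (V : supermodule (schr R[i]))
    (irrV : irreducible V)
    (qwV : quasi_whittaker phi V) :
  exists! xi : R[i], isomorphic_up_to_parity V (L_xi phi xi).
Proof.
apply: classification => //.
- exact: Num.Theory.pchar_num.
- exact: (@solve_monicpoly (R[i] : closedFieldType)).
Qed.
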